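(* Suppose that $(\mathcal{A},\mathcal{B},E,E')$ is a $C^*$-operator-valued infinitesimal probability space, and let $x,y\in\mathcal{A}$ be self-adjoint and infinitesimally monotone independent over $\mathcal{B}$. Then for all $b\in H^+(\mathcal{B})$, $$g_{x+y}(b) = G_x'(F_y(b))\big(-F_y(b)g_y(b)F_y(b)\big)+g_x(F_y(b)).$$
   Context: A $C^*$-operator-valued infinitesimal probability space $(\mathcal{A},\mathcal{B},E,E')$ consists of a unital $C^*$-algebra $\mathcal{A}$, a unital $C^*$-subalgebra $\mathcal{B}\subseteq\mathcal{A}$, a linear completely positive map $E:\mathcal{A}\to\mathcal{B}$ with $E(b)=b$ and $E(bab')=bE(a)b'$ for all $a\in\mathcal{A}$, $b,b'\in\mathcal{B}$, and a linear completely bounded self-adjoint map $E':\mathcal{A}\to\mathcal{B}$ with $E'(1)=0$ and $E'(bab')=bE'(a)b'$. The operator upper half-plane is $H^+(\mathcal{B})=\{b\in\mathcal{B}: \frac{1}{2i}(b-b^* )>0\}$, where $>0$ means positive and invertible. For self-adjoint $x\in\mathcal{A}$ and $b\in H^+(\mathcal{B})$, $b-x$ is invertible, and one sets $G_x(b)=E[(b-x)^{-1}]$ (Cauchy transform), $F_x(b)=G_x(b)^{-1}$ ($F$-transform), and $g_x(b)=E'[(b-x)^{-1}]$ (infinitesimal Cauchy transform). $G_x'(b)(\cdot)$ denotes the Fréchet derivative of $G_x$ at $b$, a linear map on $\mathcal{B}$. Let $I$ be a linearly ordered index set. Subalgebras $(\mathcal{A}_i)_{i\in I}$ of $\mathcal{A}$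 containing $\mathcal{B}$ are infinitesimally monotone independent over $\mathcal{B}$ if $$E(a_1\cdots a_n)=E(a_1\cdots a_{j-1}E(a_j)a_{j+1}\cdots a_n),$$ $$E'(a_1\cdots a_n)=E(a_1\cdots a_{j-1}E'(a_j)a_{j+1}\cdots a_n)+E'(a_1\cdots a_{j-1}E(a_j)a_{j+1}\cdots a_n)$$ whenever $a_k\in\mathcal{A}_{i_k}$, $i_k\in I$ for all $k$ and $i_{j-1}<i_j>i_{j+1}$, where one of the inequalities is eliminated if $j=1$ or $j=n$. Elements $x,y$ are infinitesimally monotone independent over $\mathcal{B}$ if the unital algebras they generate (as subalgebras containing $\mathcal{B}$) are, with the index of $x$ smaller than the index of $y$. *)

(* Defs.v *)
From HB Require Import structures.
From mathcomp Require Import all_boot all_order all_algebra.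
From mathcomp Require Import complex.
From mathcomp Require Import all_classical all_reals all_analysis.

Set Implicit Arguments.
Unset Strict Implicit.
Unset Printing Implicit Defensive.

Import Order.TTheory GRing.Theory Num.Theory.
Import numFieldNormedType.Exports.
Local Open Scope classical_set_scope.
Local Open Scope complex_scope.
Local Open Scope ring_scope.

(* Unital C*-algebras over R[i].  The norm `|a| takes its values in R[i].  The
   multiplication is part of the mixin because mathcomp's hierarchy has no join
   of rings and normed modules besides numDomainType; the algebra structure is
   put on top of it below. *)
HB.mixin Record isCStarAlgebra (R : realType) A
    of CompleteNormedModule R[i] A := {
  cstar_one : A;
  cstar_mul : A -> A -> A;
  star : A -> A;
  cstar_mulA : associative cstar_mul;
  cstar_mul1l : left_id cstar_one cstar_mul;
  cstar_mul1r : right_id cstar_one cstar_mul;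
  cstar_mulDl : left_distributive cstar_mul +%R;
  cstar_mulDr : right_distributive cstar_mul +%R;
  cstar_one_neq0 : cstar_one != 0;
  cstar_scaleAl : forall (k : R[i]) (a b : A),
    k *: cstar_mul a b = cstar_mul (k *: a) b;
  cstar_scaleAr : forall (k : R[i]) (a b : A),
    k *: cstar_mul a b = cstar_mul a (k *: b);
  starK : involutive star;
  star_conj_linear : forall (k : R[i]) (a b : A),
    star (k *: a + b) = Num.conj k *: star a + star b;
  cstar_starM : forall a b, star (cstar_mul a b) = cstar_mul (star b) (star a);
  cstar_normM : forall a b : A, `|cstar_mul a b| <= `|a| * `|b|;
  cstar_identity : forall a : A, `|cstar_mul (star a) a| = `|a| ^+ 2
}.

#[short(type="cstarAlgType")]
HB.structure Definition CStarAlgebra (R : realType) :=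
  {A of CompleteNormedModule R[i] A & isCStarAlgebra R A}.

Section CStarAlgebraRing.
Context {R : realType} {A : cstarAlgType R}.

HB.instance Definition _ := GRing.Zmodule_isNzRing.Build (CStarAlgebra.sort A)
  (@cstar_mulA R A) (@cstar_mul1l R A) (@cstar_mul1r R A) (@cstar_mulDl R A)
  (@cstar_mulDr R A) (@cstar_one_neq0 R A).

HB.instance Definition _ := GRing.Lmodule_isLalgebra.Build R[i]
  (CStarAlgebra.sort A) (@cstar_scaleAl R A).

HB.instance Definition _ := GRing.Lalgebra_isAlgebra.Build R[i]
  (CStarAlgebra.sort A) (@cstar_scaleAr R A).

Definition cstar_is_inverse (a b : A) : Prop := b * a = 1 /\ a * b = 1.

Definition cstar_unit : {pred A} := [pred a | `[< exists b, cstar_is_inverse a b >]].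

(* The inverse of an invertible element, and a itself otherwise. *)
Definition cstar_inv (a : A) : A := xget a [set b | cstar_is_inverse a b].

Fact cstar_invP a : a \in cstar_unit -> cstar_is_inverse a (cstar_inv a).
Proof. by move=> /asboolP[b ab]; rewrite /cstar_inv; case: xgetP => [c _ //|/(_ b)]. Qed.

Fact cstar_mulVr : {in cstar_unit, left_inverse 1 cstar_inv *%R}.
Proof. by move=> a /cstar_invP[]. Qed.

Fact cstar_mulrV : {in cstar_unit, right_inverse 1 cstar_inv *%R}.
Proof. by move=> a /cstar_invP[]. Qed.

Fact cstar_unitP (a b : A) : b * a = 1 /\ a * b = 1 -> a \in cstar_unit.
Proof. by move=> ab; apply/asboolP; exists b. Qed.

Fact cstar_inv_out : {in [predC cstar_unit], cstar_inv =1 id}.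
Proof.
move=> a /asboolP aN; rewrite /cstar_inv; case: xgetP => // b _ ab.
by case: aN; exists b.
Qed.

HB.instance Definition _ := GRing.NzRing_hasMulInverse.Build
  (CStarAlgebra.sort A) cstar_mulVr cstar_mulrV cstar_unitP cstar_inv_out.

End CStarAlgebraRing.

Section CStar.
Context {R : realType} {A : cstarAlgType R}.

Definition self_adjoint (a : A) : Prop := star a = a.

Definition positive (a : A) : Prop := exists c : A, a = star c * c.

(* The imaginary part (b - b^* ) / 2i. *)
Definition im_part (b : A) : A := (2 * 'i)^-1 *: (b - star b).

Definition upper_half_plane : set A :=
  [set b | positive (im_part b) /\ im_part b \is a GRing.unit].

Definition mx_star m n (X : 'M[A]_(m, n)) : 'M[A]_(n, m) := map_mx star X^T.

Definition mx_positive n (X : 'M[A]_n) : Prop :=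
  exists Y : 'M[A]_n, X = mx_star Y *m Y.

(* The norm `|v^* v| ^ (1/2) of the Hilbert A-module A^n. *)
Definition hilbert_norm n (v : 'cV[A]_n) : R :=
  Num.sqrt (complex.Re `|(mx_star v *m v) 0 0|).

(* The C*-norm of M_n(A): the operator norm of X acting on A^n. *)
Definition cstar_mx_norm n (X : 'M[A]_n) : R :=
  sup [set hilbert_norm (X *m v) | v in [set v | hilbert_norm v <= 1]].

End CStar.

Section Maps.
Context {R : realType} {A B : cstarAlgType R}.

Definition completely_positive (f : A -> B) : Prop :=
  forall n (X : 'M[A]_n), mx_positive X -> mx_positive (map_mx f X).

Definition completely_bounded (f : A -> B) : Prop :=
  exists M : R, forall n (X : 'M[A]_n),
    cstar_mx_norm (map_mx f X) <= M * cstar_mx_norm X.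

Definition self_adjoint_map (f : A -> B) : Prop :=
  forall a, f (star a) = star (f a).

End Maps.

(* The inclusion of a unital C*-subalgebra B of A: the algebra operations, the
   involution and the norm of B are those of A.  The image is closed since B is
   complete. *)
Record cstar_inclusion {R : realType} {A B : cstarAlgType R}
    (iota : {lrmorphism B -> A}) : Prop := {
  inclusion_star : forall b, iota (star b) = star (iota b);
  inclusion_norm : forall b, `|iota b| = `|b|
}.

Record cstar_inf_prob_space {R : realType} {A B : cstarAlgType R}
    (iota : {lrmorphism B -> A}) (E E' : {linear A -> B}) : Prop := {
  ips_inclusion : cstar_inclusion iota;
  ips_E_cp : completely_positive E;
  ips_E_id : forall b, E (iota b) = b;
  ips_E_bimod : forall b a b', E (iota b * a * iota b') = b * E a * b';
  ips_E'_cb : completely_bounded E';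
  ips_E'_sa : self_adjoint_map E';
  ips_E'_1 : E' 1 = 0;
  ips_E'_bimod : forall b a b', E' (iota b * a * iota b') = b * E' a * b'
}.

Section Transforms.
Context {R : realType} {A B : cstarAlgType R}.
Variables (iota : {lrmorphism B -> A}) (E E' : {linear A -> B}).

Definition cauchy_transform (x : A) (b : B) : B := E (iota b - x)^-1.

Definition F_transform (x : A) (b : B) : B := (cauchy_transform x b)^-1.

Definition inf_cauchy_transform (x : A) (b : B) : B := E' (iota b - x)^-1.

End Transforms.

Section Independence.
Context {R : realType} {A B : cstarAlgType R}.
Variables (iota : {lrmorphism B -> A}) (E E' : {linear A -> B}).

Definition subalgebra_over (S : set A) : Prop :=
  GRing.subalg_closed (mem S) /\ range iota `<=` S.

Definition generated_algebra (x : A) : set A :=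
  smallest subalgebra_over [set x].

(* The word a_1 ... a_n is a 0 * ... * a n.-1, and j ranges over the positions
   0, ..., n.-1; the values of a and idx from n on are irrelevant. *)
Definition inf_monotone_independent (disp : Order.disp_t) (I : orderType disp)
    (S : I -> set A) : Prop :=
  (forall i, subalgebra_over (S i)) /\
  forall (n : nat) (a : nat -> A) (idx : nat -> I) (j : nat),
    (j < n)%N ->
    (forall k, (k < n)%N -> S (idx k) (a k)) ->
    ((0 < j)%N -> (idx j.-1 < idx j)%O) ->
    ((j.+1 < n)%N -> (idx j.+1 < idx j)%O) ->
    let w := \prod_(0 <= k < n) a k in
    let w_with (b : B) :=
      \prod_(0 <= k < j) a k * iota b * \prod_(j.+1 <= k < n) a k in
    E w = E (w_with (E (a j))) /\
    E' w = E (w_with (E' (a j))) + E' (w_with (E (a j))).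

(* The index set is bool, with false < true: x has the smaller index. *)
Definition inf_monotone_independent_pair (x y : A) : Prop :=
  inf_monotone_independent
    (fun i : bool => if i then generated_algebra y else generated_algebra x).

End Independence.

(* Main.v *)
Require Import Defs.
From HB Require Import structures.
From mathcomp Require Import all_boot all_order all_algebra.
From mathcomp Require Import complex.
From mathcomp Require Import all_classical all_reals all_analysis.
From mathcomp Require Import ring lra.

Set Implicit Arguments.
Unset Strict Implicit.
Unset Printing Implicit Defensive.

Import Order.TTheory GRing.Theory Num.Theory.
Import numFieldNormedType.Exports.
Local Open Scope classical_set_scope.
Local Open Scope ring_scope.

(* Write r = (b - y)^-1, G = E r, F = G^-1, q = (F - x)^-1, w = (b - x - y)^-1,
   so that w = r + r x w.  For u in the closed algebra generated by x,
   independence at the letter r gives E(u w) = E(u G) + E(u G x w); putting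
   u' q F for u turns this into E(u' w) = E(u' q).  The same step for E', at
   u = q F, gives E'(w) = E'(q) + E(q F E'(r) (1 + x w)), where w may be
   replaced by q, and 1 + x q = F q.  Since h |-> - E(q h q) is the derivative of
   G_x at F, this is the formula.

   Independence speaks about words in the generated algebras only.  It extends
   to resolvents because E and E' are bounded and because each resolvent is a
   single Neumann series: if Im a > 0, then |a - iT| < T for large T.  This
   needs no analytic continuation in b, but it does need the order theory of
   C*-algebras: square roots, positivity of c^* c, contractivity of E. *)

(** Complete positivity transports elements of the form c^* c, whereas inverses come from norm
    bounds |T - a| < T. The bridge between the two languages is the theorem that c^* c is
    nonnegative ([star_mul_npos]), and it is reached without spectra or functional calculus: square
    roots are limits of a contraction, and every comparison reduces to a norm estimate or to sums
    and products of commuting squares. The yield is a short list of facts: a strictly positive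
    imaginary part gives a Neumann series for the inverse, E is a contraction, and F_y(b) lies again
    in the half-plane, so that q exists.

    Independence applies to r x w although w mixes x and y, because it constrains only the
    neighbours of the letter r: the letter x shields r from whatever follows. *)

Section RealNorm.
Context {R : realType} {A : cstarAlgType R}.
Implicit Types (a b c : A) (t : R).

Definition rsc (t : R) : R[i] := (t%:C)%C.

(* The norm of A takes its values in R[i]; [nm] is the same norm, R-valued. *)
Definition nm (a : A) : R := complex.Re `|a|.

Lemma nmE a : `|a| = rsc (nm a).
Proof. by rewrite /rsc /nm RRe_real // ger0_real. Qed.

Lemma nm_ge0 a : 0 <= nm a.
Proof. by rewrite -ler0c -/(rsc (nm a)) -nmE. Qed.

Lemma nm0 : nm 0 = 0.
Proof. by rewrite /nm normr0. Qed.

Lemma nm_eq0 a : nm a = 0 -> a = 0.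
Proof. by move=> h; apply/eqP; rewrite -normr_eq0 nmE h. Qed.

Lemma nmD a b : nm (a + b) <= nm a + nm b.
Proof.
by rewrite -lecR; have := ler_normD a b; rewrite !nmE /rsc -rmorphD.
Qed.

Lemma nmN a : nm (- a) = nm a.
Proof. by rewrite /nm normrN. Qed.

Lemma nmB a b : nm (a - b) <= nm a + nm b.
Proof. by rewrite -(nmN b) nmD. Qed.

Lemma nm_dist a b : nm (a - b) = nm (b - a).
Proof. by rewrite -nmN opprB. Qed.

Lemma nm_trans b a c : nm (a - c) <= nm (a - b) + nm (b - c).
Proof. by rewrite -{1}(subrK b a) -addrA nmD. Qed.

Lemma nmM a b : nm (a * b) <= nm a * nm b.
Proof.
by rewrite -lecR; have := cstar_normM a b; rewrite !nmE /rsc -rmorphM.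
Qed.

Lemma nmZ t a : nm (rsc t *: a) = `|t| * nm a.
Proof.
apply: complexI; rewrite -/(rsc _) -nmE normrZ nmE /rsc rmorphM; congr (_ * _).
by rewrite normc_def /= expr0n addr0 sqrtr_sqr.
Qed.

Lemma nmiZ a : nm ('i *: a) = nm a.
Proof. by apply: complexI; rewrite -!/(rsc _) -!nmE normrZ normCi mul1r. Qed.

Lemma nm_starM a : nm (star a * a) = nm a ^+ 2.
Proof.
apply: complexI; rewrite rmorphXn /= -/(rsc (nm (star a * a))) -/(rsc (nm a)).
by rewrite -!nmE; exact: cstar_identity.
Qed.

Lemma starZ (k : R[i]) a : star (k *: a) = Num.conj k *: star a.
Proof.
have h0 : star (0 : A) = 0.
  have := @star_conj_linear R A 1 0 0.
  rewrite conjC1 !scale1r addr0 => /eqP.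
  by rewrite -subr_eq0 opprD addNKr oppr_eq0 => /eqP.
by have := @star_conj_linear R A k a 0; rewrite h0 !addr0.
Qed.

Lemma starD a b : star (a + b) = star a + star b.
Proof. by have := @star_conj_linear R A 1 a b; rewrite conjC1 !scale1r. Qed.

Lemma starN a : star (- a) = - star a.
Proof. by rewrite -[in LHS]scaleN1r starZ rmorphN rmorph1 scaleN1r. Qed.

Lemma starB a b : star (a - b) = star a - star b.
Proof. by rewrite starD starN. Qed.

Lemma starM a b : star (a * b) = star b * star a.
Proof. exact: cstar_starM. Qed.

Lemma starr0 : star (0 : A) = 0.
Proof. by have := starB (0 : A) 0; rewrite !subrr. Qed.

Lemma star1 : star (1 : A) = 1.
Proof. by rewrite -[RHS]starK -[in RHS](mulr1 (star 1)) starM starK mulr1. Qed.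

Lemma conj_rsc t : Num.conj (rsc t) = rsc t.
Proof. by apply: conj_Creal; apply/complex_realP; exists t. Qed.

Lemma starZr t a : star (rsc t *: a) = rsc t *: star a.
Proof. by rewrite starZ conj_rsc. Qed.

Lemma stariZ a : star ('i *: a) = - ('i *: star a).
Proof. by rewrite starZ conjCi scaleNr. Qed.

Lemma star_inv a : a \is a GRing.unit -> star a^-1 = (star a)^-1.
Proof.
move=> ua; rewrite -[RHS]mul1r; have h : star a^-1 * star a = 1.
  by rewrite -starM divrr // star1.
have h' : star a * star a^-1 = 1 by rewrite -starM mulVr // star1.
have us : star a \is a GRing.unit by apply/unitrP; exists (star a^-1).
by rewrite -h mulrK.
Qed.

Lemma unit_star a : a \is a GRing.unit -> star a \is a GRing.unit.
Proof.
move=> ua; apply/unitrP; exists (star a^-1).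
by rewrite -!starM divrr // mulVr // star1.
Qed.

Lemma nm_star a : nm (star a) = nm a.
Proof.
have H b : nm b <= nm (star b).
  have [->|] := eqVneq (nm b) 0; first exact: nm_ge0.
  move=> b0; have {}b0 : 0 < nm b by rewrite lt0r b0 nm_ge0.
  by rewrite -(ler_pM2r b0) -expr2 -nm_starM nmM.
by apply/eqP; rewrite eq_le H -{2}(starK a) H.
Qed.

Lemma nm1 : nm (1 : A) = 1.
Proof.
have := nm_starM (1 : A); rewrite star1 mulr1 expr2 => /eqP.
rewrite -{1}[nm 1]mulr1 -subr_eq0 -mulrBr mulf_eq0 => /orP[/eqP /nm_eq0 /eqP|].
  by rewrite oner_eq0.
by rewrite subr_eq0 => /eqP <-.
Qed.

Lemma nm_sa_sqr a : star a = a -> nm (a * a) = nm a ^+ 2.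
Proof. by move=> ha; rewrite -{1}ha nm_starM. Qed.

Lemma nm_sc t : nm (rsc t *: (1 : A)) = `|t|.
Proof. by rewrite nmZ nm1 mulr1. Qed.

Lemma nmX a n : nm (a ^+ n) <= nm a ^+ n.
Proof.
elim: n => [|n IH]; first by rewrite !expr0 nm1.
by rewrite !exprS (le_trans (nmM _ _)) // ler_wpM2l // nm_ge0.
Qed.

End RealNorm.

(** * Limits of sequences with geometrically decreasing steps *)

Lemma geometric_lt {R : realType} (C q e : R) :
  0 <= q < 1 -> 0 < e -> exists n, C * q ^+ n < e.
Proof.
move=> /andP[q0 q1] e0.
have : (C * q ^+ n @[n --> \oo] --> 0)%classic.
  by apply: cvg_geometric; rewrite ger0_norm.
move=> /cvgrPdist_lt /(_ e e0) [N _ /(_ N (leqnn N))] /=.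
by rewrite sub0r normrN => /(le_lt_trans (ler_norm _)) h; exists N.
Qed.

Section Completeness.
Context {R : realType} {A : cstarAlgType R}.

Lemma geometric_dist (u : nat -> A) (C q : R) : 0 <= q < 1 ->
  (forall n, nm (u n.+1 - u n) <= C * q ^+ n) ->
  forall n k, nm (u (n + k)%N - u n) <= C * q ^+ n * (1 - q)^-1.
Proof.
move=> /andP[q0 q1] hu n k.
have C0 : 0 <= C by have := le_trans (nm_ge0 _) (hu 0%N); rewrite mulr1.
have q1' : 0 < 1 - q by rewrite subr_gt0.
suff : nm (u (n + k)%N - u n) <= C * q ^+ n * ((1 - q ^+ k) / (1 - q)).
  move/le_trans; apply; rewrite ler_wpM2l ?mulr_ge0 ?exprn_ge0 //.
  by rewrite ler_pdivrMr // mulVf ?gt_eqF // lerBlDr lerDl exprn_ge0.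
elim: k => [|k IH]; first by rewrite addn0 subrr nm0 expr0 subrr mul0r mulr0.
rewrite addnS (le_trans (nm_trans (u (n + k)%N) _ _)) //.
apply: (le_trans (lerD (hu _) IH)).
rewrite le_eqVlt; apply/orP; left; apply/eqP.
rewrite exprD exprS; move: (q ^+ n) (q ^+ k) => a b.
by field; rewrite gt_eqF.
Qed.

(** Completeness of [A] enters here. The rate is kept in the conclusion because identities for the
    limit are later proved by bounding their defect by a geometric sequence and applying
    [nm_geometric_eq0]. *)
Lemma geometric_limit (u : nat -> A) (C q : R) : 0 <= q < 1 ->
  (forall n, nm (u n.+1 - u n) <= C * q ^+ n) ->
  exists l, forall n, nm (u n - l) <= C * q ^+ n * (1 - q)^-1.
Proof.
move=> hq hu; have hd := geometric_dist hq hu.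
have /andP[q0 q1] := hq.
have C0 : 0 <= C by have := le_trans (nm_ge0 _) (hu 0%N); rewrite mulr1.
have q1' : 0 < 1 - q by rewrite subr_gt0.
have cu : cvg (u @ \oo).
  apply/cauchy_cvgP/cauchyP => e e0.
  have /complex_realP[r re] : e \is Num.real by rewrite gtr0_real.
  have r0 : 0 < r by rewrite re ltcR in e0.
  have [n hn] := @geometric_lt R (C * (1 - q)^-1) q r hq r0.
  exists (u n), n => // m /= nm_; rewrite -ball_normE /= nmE re ltcR nm_dist.
  rewrite -(subnKC nm_); apply: le_lt_trans (hd _ _) _.
  by rewrite mulrAC.
exists (lim (u @ \oo)) => n.
apply/ler_addgt0Pr => e e0.
have e0' : 0 < rsc e by rewrite ltcR.
have /cvgrPdist_lt /(_ _ e0') [N _ hN] := cu.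
have := hN (n + N)%N (leq_addl _ _); rewrite /= nmE ltcR => h.
apply: le_trans (nm_trans (u (n + N)%N) _ _) _.
by apply: lerD; rewrite nm_dist; [exact: hd|exact: ltW].
Qed.

End Completeness.

(* Reflexive normalisation of expressions in an associative algebra: a
   polynomial in noncommuting variables becomes a list of scalars attached to
   words, and an identity reduces to the vanishing of the collected scalars. *)
Inductive nc_exp (K : Type) :=
  | NCvar of nat | NCone | NCzero | NCopp of nc_exp K | NCscale of K & nc_exp K
  | NCadd of nc_exp K & nc_exp K | NCmul of nc_exp K & nc_exp K.
Arguments NCvar {K}. Arguments NCone {K}. Arguments NCzero {K}.

Section NoncommutativeNormalisation.
Context {K : comNzRingType} {A : algType K}.
Implicit Types (e : nc_exp K) (w : seq nat) (l : seq (K * seq nat)).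

Fixpoint nc_eval (v : seq A) e : A :=
  match e with
  | NCvar n => nth 0 v n
  | NCone => 1
  | NCzero => 0
  | NCopp e => - nc_eval v e
  | NCscale k e => k *: nc_eval v e
  | NCadd e1 e2 => nc_eval v e1 + nc_eval v e2
  | NCmul e1 e2 => nc_eval v e1 * nc_eval v e2
  end.

Fixpoint nc_scale (k : K) w l : seq (K * seq nat) :=
  match l with
  | [::] => [::]
  | c :: l => (k * c.1, w ++ c.2) :: nc_scale k w l
  end.

Fixpoint nc_mul l1 l2 :=
  match l1 with
  | [::] => [::]
  | c :: l1 => nc_scale c.1 c.2 l2 ++ nc_mul l1 l2
  end.

Fixpoint nc_norm e : seq (K * seq nat) :=
  match e with
  | NCvar n => [:: (1, [:: n])]
  | NCone => [:: (1, [::])]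
  | NCzero => [::]
  | NCopp e => nc_scale (-1) [::] (nc_norm e)
  | NCscale k e => nc_scale k [::] (nc_norm e)
  | NCadd e1 e2 => nc_norm e1 ++ nc_norm e2
  | NCmul e1 e2 => nc_mul (nc_norm e1) (nc_norm e2)
  end.

(** Built on [Nat.eqb], which [nc_ring] lets [cbv] unfold: words are compared by computation while
    the scalars stay symbolic. *)
Fixpoint nc_eqw w1 w2 :=
  match w1, w2 with
  | [::], [::] => true
  | n1 :: w1, n2 :: w2 => if Nat.eqb n1 n2 then nc_eqw w1 w2 else false
  | _, _ => false
  end.

Fixpoint nc_insert (c : K * seq nat) l :=
  match l with
  | [::] => [:: c]
  | d :: l => if nc_eqw c.2 d.2 then (c.1 + d.1, d.2) :: l
              else d :: nc_insert c l
  end.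

Fixpoint nc_collect l :=
  match l with [::] => [::] | c :: l => nc_insert c (nc_collect l) end.

Fixpoint nc_vanish l : Prop :=
  match l with [::] => True | c :: l => c.1 = 0 /\ nc_vanish l end.

Definition nc_word (v : seq A) w : A := \prod_(n <- w) nth 0 v n.

Definition nc_sum (v : seq A) l : A := \sum_(c <- l) c.1 *: nc_word v c.2.

Lemma nc_sum_cons v c l : nc_sum v (c :: l) = c.1 *: nc_word v c.2 + nc_sum v l.
Proof. by rewrite /nc_sum big_cons. Qed.

Lemma nc_sum_cat v l1 l2 : nc_sum v (l1 ++ l2) = nc_sum v l1 + nc_sum v l2.
Proof. by rewrite /nc_sum big_cat. Qed.

Lemma nc_sum_scale v k w l :
  nc_sum v (nc_scale k w l) = k *: (nc_word v w * nc_sum v l).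
Proof.
elim: l => [|c l IH] /=; first by rewrite /nc_sum !big_nil mulr0 scaler0.
rewrite !nc_sum_cons IH mulrDr scalerDr /=; congr (_ + _).
by rewrite -scalerAr scalerA /nc_word big_cat.
Qed.

Lemma nc_sum_mul v l1 l2 : nc_sum v (nc_mul l1 l2) = nc_sum v l1 * nc_sum v l2.
Proof.
elim: l1 => [|c l IH] /=; first by rewrite /nc_sum !big_nil mul0r.
by rewrite nc_sum_cat nc_sum_scale IH nc_sum_cons mulrDl scalerAl.
Qed.

Lemma nc_normP v e : nc_eval v e = nc_sum v (nc_norm e).
Proof.
have w0 : nc_word v [::] = 1 by rewrite /nc_word big_nil.
elim: e => [n|||e IH|k e IH|e1 IH1 e2 IH2|e1 IH1 e2 IH2] /=.
- by rewrite /nc_sum /nc_word !big_seq1 scale1r.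
- by rewrite /nc_sum big_seq1 w0 scale1r.
- by rewrite /nc_sum big_nil.
- by rewrite nc_sum_scale w0 mul1r IH scaleN1r.
- by rewrite nc_sum_scale w0 mul1r IH.
- by rewrite nc_sum_cat IH1 IH2.
- by rewrite nc_sum_mul IH1 IH2.
Qed.

Lemma nc_eqwP w1 w2 : nc_eqw w1 w2 -> w1 = w2.
Proof.
elim: w1 w2 => [|n1 w1 IH] [|n2 w2] //=.
by case h : (Nat.eqb n1 n2) => // /IH ->; rewrite (PeanoNat.Nat.eqb_eq n1 n2).1.
Qed.

Lemma nc_collectP v l : nc_sum v (nc_collect l) = nc_sum v l.
Proof.
have ins c l' : nc_sum v (nc_insert c l') = c.1 *: nc_word v c.2 + nc_sum v l'.
  elim: l' => [|d l' IH] /=; first by rewrite nc_sum_cons.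
  case h : nc_eqw; last by rewrite !nc_sum_cons IH addrCA.
  by rewrite !nc_sum_cons /= (nc_eqwP h) scalerDl addrA.
by elim: l => //= c l IH; rewrite ins IH nc_sum_cons.
Qed.

Lemma nc_eq v e1 e2 :
  nc_vanish (nc_collect (nc_norm (NCadd e1 (NCopp e2)))) ->
  nc_eval v e1 = nc_eval v e2.
Proof.
move=> h; apply/eqP; rewrite -subr_eq0; apply/eqP.
rewrite -[LHS]/(nc_eval v (NCadd e1 (NCopp e2))) nc_normP -nc_collectP.
move: (nc_collect _) h; elim=> [|c l IH] /=; first by rewrite /nc_sum big_nil.
by move=> [c0 /IH h]; rewrite nc_sum_cons c0 h scale0r addr0.
Qed.

End NoncommutativeNormalisation.

Ltac nc_index x v :=
  lazymatch v with
  | x :: _ => constr:(0%N)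
  | _ :: ?v => let n := nc_index x v in constr:(S n)
  end.

Ltac nc_mem x v :=
  lazymatch v with
  | [::] => false
  | x :: _ => true
  | _ :: ?v => nc_mem x v
  end.

Ltac nc_vars v t :=
  lazymatch t with
  | (?a + ?b)%R => let v := nc_vars v a in nc_vars v b
  | (?a * ?b)%R => let v := nc_vars v a in nc_vars v b
  | (- ?a)%R => nc_vars v a
  | (?k *: ?a)%R => nc_vars v a
  | 1%R => v
  | 0%R => v
  | _ => lazymatch nc_mem t v with true => v | false => constr:(t :: v) end
  end.

Ltac nc_reify K v t :=
  lazymatch t with
  | (?a + ?b)%R => let a := nc_reify K v a in let b := nc_reify K v b in
      constr:(@NCadd K a b)
  | (?a * ?b)%R => let a := nc_reify K v a in let b := nc_reify K v b in
      constr:(@NCmul K a b)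
  | (- ?a)%R => let a := nc_reify K v a in constr:(@NCopp K a)
  | (?k *: ?a)%R => let a := nc_reify K v a in constr:(@NCscale K k a)
  | 1%R => constr:(@NCone K)
  | 0%R => constr:(@NCzero K)
  | _ => let n := nc_index t v in constr:(@NCvar K n)
  end.

(* Leaves one equation between scalars for each word. *)
Ltac nc_ring R A :=
  rewrite ?expr2;
  lazymatch goal with |- ?s = ?t =>
    let v := nc_vars (@nil A) s in
    let v := nc_vars v t in
    let e1 := nc_reify (complex R) v s in
    let e2 := nc_reify (complex R) v t in
    apply: (@nc_eq _ A v e1 e2);
    cbv [nc_vanish nc_collect nc_insert nc_eqw nc_norm nc_mul nc_scale Nat.eqb
         fst snd cat];
    repeat (split; [rewrite /rsc; try ring | ]); try exact I
  end.

(** * Positivity in C*-algebras *)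

Section StrictlyPositive.
Context {R : realType} {A : cstarAlgType R}.
Implicit Types (a b c h p v w z : A) (t e : R) (V : set A).

(* Strict positivity without order or spectrum: for selfadjoint a the bound says
   that the spectrum lies in (0, 2T). *)
Definition spos a := star a = a /\ exists T, nm (rsc T *: 1 - a) < T.

(** Nonnegativity, phrased through strictly positive shifts, so that square roots are only ever
    taken of strictly positive elements. *)
Definition npos a := forall e, 0 < e -> spos (a + rsc e *: 1).

(** Serves as an induction predicate: a linear property that passes to norm limits reaches a Neumann
    series from its partial sums. *)
Definition closed_subspace V :=
  (forall k a b, V a -> V b -> V (k *: a + b)) /\
  (forall z, (forall e, 0 < e -> exists2 s, V s & nm (z - s) < e) -> V z).

Lemma nm_geometric_eq0 a (C q : R) : 0 <= q < 1 ->
  (forall n, nm a <= C * q ^+ n) -> a = 0.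
Proof.
move=> hq h; apply: nm_eq0; apply/eqP; rewrite eq_le nm_ge0 andbT.
apply/ler_addgt0Pr => e e0; rewrite add0r.
by have [n hn] := geometric_lt C hq e0; exact: le_trans (h n) (ltW hn).
Qed.

(** The last clause is an induction principle for the inverse: the partial sums satisfy u (n + 1) =
    1 + p (u n), so [V] contains all of them, hence their limit. *)
Lemma neumann p : nm p < 1 -> exists q,
  [/\ (1 - p) * q = 1, q * (1 - p) = 1 &
      forall V, closed_subspace V -> V 1 -> (forall v, V v -> V (p * v)) -> V q].
Proof.
move=> p1; have hq : 0 <= nm p < 1 by rewrite nm_ge0.
pose u n : A := \sum_(0 <= i < n) p ^+ i.
have uS n : u n.+1 = u n + p ^+ n by rewrite /u big_nat_recr.
have hu n : nm (u n.+1 - u n) <= 1 * nm p ^+ n.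
  by rewrite uS addrAC subrr add0r mul1r nmX.
have [q hql] := geometric_limit hq hu.
have upl n : p * u n = u n.+1 - 1.
  elim: n => [|n IH]; first by rewrite uS /u big_geq // mulr0 add0r subrr.
  by rewrite [in LHS]uS mulrDr IH -exprS [in RHS]uS addrAC.
have upr n : u n * p = u n.+1 - 1.
  elim: n => [|n IH]; first by rewrite uS /u big_geq // mul0r add0r subrr.
  by rewrite [in LHS]uS mulrDl IH -exprSr [in RHS]uS addrAC.
(* Both residuals, (1 - p) q - 1 and q (1 - p) - 1, split into the error of a partial sum and - p^n;
   this bounds the two alike. *)
have big a b n : nm a <= (1 * nm p ^+ n / (1 - nm p)) * nm (1 - p) ->
    nm b <= nm p ^+ n ->
    nm (a - b) <= ((1 - nm p)^-1 * nm (1 - p) + 1) * nm p ^+ n.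
  move=> ha hb; apply: le_trans (nmB _ _) _; apply: le_trans (lerD ha hb) _.
  by rewrite le_eqVlt mul1r mulrDl mul1r -mulrA mulrC eqxx.
exists q; split.
- apply/eqP; rewrite -subr_eq0; apply/eqP; apply: (nm_geometric_eq0 hq) => n.
  have -> : (1 - p) * q - 1 = - ((1 - p) * (u n - q)) - p ^+ n.
    have := upl n; rewrite uS => h.
    have -> : p ^+ n = p * u n + 1 - u n by rewrite h subrK addrAC subrr add0r.
    by nc_ring R A.
  apply: big; last exact: nmX.
  by rewrite nmN (le_trans (nmM _ _)) // mulrC ler_wpM2r ?nm_ge0.
- apply/eqP; rewrite -subr_eq0; apply/eqP; apply: (nm_geometric_eq0 hq) => n.
  have -> : q * (1 - p) - 1 = - ((u n - q) * (1 - p)) - p ^+ n.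
    have := upr n; rewrite uS => h.
    have -> : p ^+ n = u n * p + 1 - u n by rewrite h subrK addrAC subrr add0r.
    by nc_ring R A.
  apply: big; last exact: nmX.
  by rewrite nmN (le_trans (nmM _ _)) // ler_wpM2r ?nm_ge0.
- move=> V [Vl Vc] V1 Vp; apply: Vc => e e0.
  have V0 : V 0 by have := Vl (-1) 1 1 V1 V1; rewrite scaleN1r addNr.
  have Vu n : V (u n).
    elim: n => [|n IH]; first by rewrite /u big_geq.
    have := Vl 1 _ _ V1 (Vp _ IH).
    by rewrite upl scale1r addrC subrK.
  have [n hn] := @geometric_lt R (1 - nm p)^-1 _ _ hq e0.
  exists (u n) => //; rewrite nm_dist; apply: le_lt_trans (hql n) _.
  by rewrite mul1r mulrC.
Qed.

Lemma rscM t e : rsc (t * e) = rsc t * rsc e.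
Proof. exact: rmorphM. Qed.

Lemma rsc1 : rsc (1 : R) = 1.
Proof. exact: rmorph1. Qed.

Lemma rscV t : t != 0 -> rsc t * rsc t^-1 = 1.
Proof. by move=> t0; rewrite -rscM divff. Qed.

Lemma rscD t e : rsc (t + e) = rsc t + rsc e.
Proof. exact: rmorphD. Qed.

Lemma star_sc t : star (rsc t *: 1 : A) = rsc t *: 1.
Proof. by rewrite starZr star1. Qed.

Lemma spos_sa a : spos a -> star a = a.
Proof. by case. Qed.

Lemma spos_gt0 a : spos a -> exists2 T, 0 < T & nm (rsc T *: 1 - a) < T.
Proof. by case=> _ [T h]; exists T => //; exact: le_lt_trans (nm_ge0 _) h. Qed.

Lemma nm_sc_shift a e : 0 <= e -> nm (a + rsc e *: 1) <= nm a + e.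
Proof. by move=> e0; rewrite (le_trans (nmD _ _)) // nm_sc ger0_norm. Qed.

(** Enlarging T by s enlarges |T - a| by at most s, so the gap found at one T persists. A gap that
    does not depend on T is what [im_spos_inv] needs, where T has to be large. *)
Lemma spos_large a : spos a -> exists e T0, [/\ 0 < e, e <= T0 &
  forall T, T0 <= T -> nm (rsc T *: 1 - a) <= T - e].
Proof.
move=> [sa [T hT]]; exists (T - nm (rsc T *: 1 - a)), T; split.
- by rewrite subr_gt0.
- by rewrite lerBlDr lerDl nm_ge0.
- move=> S TS.
  have -> : rsc S *: 1 - a = (rsc T *: 1 - a) + rsc (S - T) *: 1.
    by rewrite rscD; nc_ring R A.
  apply: (le_trans (nm_sc_shift _ _)); first by rewrite subr_ge0.
  by lra.
Qed.

Lemma sposD a b : spos a -> spos b -> spos (a + b).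
Proof.
move=> [sa [T hT]] [sb [S hS]]; split; first by rewrite starD sa sb.
exists (T + S); have -> : rsc (T + S) *: 1 - (a + b) =
  (rsc T *: 1 - a) + (rsc S *: 1 - b) by rewrite rscD; nc_ring R A.
by apply: le_lt_trans (nmD _ _) _; rewrite ltrD.
Qed.

Lemma sposZ t a : 0 < t -> spos a -> spos (rsc t *: a).
Proof.
move=> t0 [sa [T hT]]; split; first by rewrite starZr sa.
exists (t * T); have -> : rsc (t * T) *: 1 - rsc t *: a =
  rsc t *: (rsc T *: 1 - a) by rewrite rscM; nc_ring R A.
by rewrite nmZ gtr0_norm // ltr_pM2l.
Qed.

Lemma spos_bound a t : star a = a -> nm a < t -> spos (rsc t *: 1 - a).
Proof.
move=> sa at_; split; first by rewrite starB star_sc sa.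
by exists t; rewrite opprB addrC subrK.
Qed.

Lemma spos_sc t : 0 < t -> spos (rsc t *: 1 : A).
Proof.
by move=> t0; rewrite -[_ *: 1]subr0; apply: spos_bound; rewrite ?starr0 ?nm0.
Qed.

Lemma spos_npos a : spos a -> npos a.
Proof. by move=> ha e e0; apply: sposD => //; exact: spos_sc. Qed.

Lemma spos_shift a : spos a -> exists2 e, 0 < e & spos (a - rsc e *: 1).
Proof.
move=> [sa [T hT]]; pose e := (T - nm (rsc T *: 1 - a)) / 2.
have e0 : 0 < e by rewrite divr_gt0 // subr_gt0.
exists e => //; split; first by rewrite starB star_sc sa.
exists T; have -> : rsc T *: 1 - (a - rsc e *: 1) = (rsc T *: 1 - a) + rsc e *: 1.
  by nc_ring R A.
apply: (le_lt_trans (nm_sc_shift _ _)); first exact: ltW.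
by rewrite /e; lra.
Qed.

Lemma npos_sa a : npos a -> star a = a.
Proof.
by move=> /(_ 1 ltr01) [+ _]; rewrite starD star_sc => /addIr.
Qed.

Lemma npos_spos a b : npos a -> spos b -> spos (a + b).
Proof.
move=> ha /spos_shift [e e0 hb].
have -> : a + b = (a + rsc e *: 1) + (b - rsc e *: 1) by nc_ring R A.
by apply: sposD => //; exact: ha.
Qed.

Lemma nposD a b : npos a -> npos b -> npos (a + b).
Proof. by move=> ha hb e e0; rewrite -addrA; apply: npos_spos => //; exact: hb. Qed.

Lemma npos0 : npos (0 : A).
Proof. by move=> e e0; rewrite add0r; exact: spos_sc. Qed.

Lemma nposZ t a : 0 <= t -> npos a -> npos (rsc t *: a).
Proof.
rewrite le_eqVlt => /orP[/eqP <- _|t0 ha e e0].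
  by rewrite /rsc rmorph0 scale0r; exact: npos0.
have -> : rsc t *: a + rsc e *: 1 = rsc t *: (a + rsc (e / t) *: 1).
  rewrite rscM; have := rscV (lt0r_neq0 t0) => h.
  by nc_ring R A; ring: h.
by apply: sposZ => //; apply: ha; rewrite divr_gt0.
Qed.

Lemma npos_bound a t : star a = a -> nm a <= t -> npos (rsc t *: 1 - a).
Proof.
move=> sa at_ e e0.
have -> : rsc t *: 1 - a + rsc e *: 1 = rsc (t + e) *: 1 - a.
  by rewrite rscD; nc_ring R A.
by apply: spos_bound => //; rewrite (le_lt_trans at_) // ltrDl.
Qed.

Lemma spos_unit a : spos a -> a \is a GRing.unit.
Proof.
move=> /spos_gt0 [T T0 hT].
have Tn := rscV (lt0r_neq0 T0).
have [|q [q1 q2 _]] := @neumann (rsc T^-1 *: (rsc T *: 1 - a)).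
  by rewrite nmZ gtr0_norm ?invr_gt0 // -ltr_pdivlMl ?invr_gt0 // invrK mulr1.
have e : 1 - rsc T^-1 *: (rsc T *: 1 - a) = rsc T^-1 *: a.
  by nc_ring R A; ring: Tn.
move: q1 q2; rewrite e => q1 q2; apply/unitrP; exists (rsc T^-1 *: q); split.
  by rewrite -scalerAl scalerAr.
by rewrite -scalerAr scalerAl.
Qed.

(** Here z is 1 - (1 - p)^(1/2). The iteration stays in the ball of radius |p|, since (|p| + |p|^2)
    / 2 <= |p|, and contracts there with factor |p|. The commutation clause passes from the iterates
    to the limit; it stands in for functional calculus, since it makes roots of commuting elements
    commute. *)
Lemma sqrt_one_minus p : star p = p -> nm p < 1 -> exists z,
  [/\ star z = z, nm z < 1, (1 - z) * (1 - z) = 1 - p &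
      forall c, c * p = p * c -> c * z = z * c].
Proof.
move=> sp p1; have hq : 0 <= nm p < 1 by rewrite nm_ge0.
have p0 := nm_ge0 p.
pose half : R[i] := rsc 2^-1.
have h2 : half + half = 1 by rewrite /half -rscD (_ : 2^-1 + 2^-1 = 1) ?rsc1 //; field.
have nmh a : nm (half *: a) = 2^-1 * nm a.
  by rewrite nmZ ger0_norm // invr_ge0.
(* The fixed points of f satisfy 2 z = p + z ^ 2. *)
pose f z := half *: (p + z * z); pose u n := iter n f 0.
have uS n : u n.+1 = half *: (p + u n * u n) by [].
have ub n : nm (u n) <= nm p.
  elim: n => [|n IH]; first by rewrite nm0.
  rewrite uS nmh (le_trans (ler_wpM2l _ (nmD _ _))) ?invr_ge0 //.
  have : nm (u n * u n) <= nm p.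
    apply: le_trans (nmM _ _) _; rewrite -[leRHS]mulr1.
    by apply: ler_pM; rewrite ?nm_ge0 // (le_trans IH) // ltW.
  by lra.
have hu n : nm (u n.+1 - u n) <= nm p * nm p ^+ n.
  elim: n => [|n IH]; first by rewrite subr0 expr0 mulr1 ub.
  have -> : u n.+2 - u n.+1 =
      half *: (u n.+1 * (u n.+1 - u n) + (u n.+1 - u n) * u n).
    by rewrite (uS n.+1) [X in _ - X]uS; nc_ring R A.
  rewrite nmh; have := nmD (u n.+1 * (u n.+1 - u n)) ((u n.+1 - u n) * u n).
  have := nmM (u n.+1) (u n.+1 - u n); have := nmM (u n.+1 - u n) (u n).
  have B1 : nm (u n.+1) * nm (u n.+1 - u n) <= nm p * (nm p * nm p ^+ n).
    by apply: ler_pM; rewrite ?nm_ge0.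
  have B2 : nm (u n.+1 - u n) * nm (u n) <= nm p * (nm p * nm p ^+ n).
    by rewrite mulrC; apply: ler_pM; rewrite ?nm_ge0.
  by rewrite exprS; lra.
have [z hz] := geometric_limit hq hu.
pose K := nm p / (1 - nm p).
have {}hz n : nm (u n - z) <= K * nm p ^+ n by rewrite mulrAC; exact: hz.
have zb : nm z <= nm p.
  apply/ler_addgt0Pr => e e0; have [n hn] := geometric_lt K hq e0.
  have := nm_trans z (u n) 0; have := ub n; have := nmB (u n) (u n - z).
  have -> : u n - (u n - z) = z by nc_ring R A.
  by have := hz n; lra.
have close a (C : R) : 0 <= C -> (forall n, nm a <= C * nm (u n - z)) -> a = 0.
  move=> C0 h; apply: (@nm_geometric_eq0 _ (C * K) _ hq) => n.
  by rewrite -mulrA (le_trans (h n)) // ler_wpM2l.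
have usa n : star (u n) = u n.
  elim: n => [|n IH]; first exact: starr0.
  by rewrite uS starZr starD starM sp IH.
exists z; split.
- apply/eqP; rewrite -subr_eq0; apply/eqP; apply: (close _ 2) => // n.
  have -> : star z - z = (u n - z) - star (u n - z).
    by rewrite starB usa; nc_ring R A.
  by rewrite (le_trans (nmB _ _)) // nm_star mulr_natl mulr2n.
- exact: le_lt_trans p1.
- suff E : z = f z.
    have E2 : z + z = p + z * z.
      by rewrite {1 2}E /f -scalerDl h2 scale1r.
    have -> : p = (z + z) - z * z by rewrite E2 addrK.
    by nc_ring R A.
  apply/eqP; rewrite -subr_eq0; apply/eqP; apply: (nm_geometric_eq0 (C := 2 * K) hq) => n.
  have -> : z - f z = - (u n.+1 - z) + half *: (u n * (u n - z) + (u n - z) * z).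
    by rewrite uS /f; nc_ring R A.
  have := nmD (- (u n.+1 - z)) (half *: (u n * (u n - z) + (u n - z) * z)).
  rewrite nmh nmN.
  have := nmD (u n * (u n - z)) ((u n - z) * z).
  have := nmM (u n) (u n - z); have := nmM (u n - z) z.
  have B1 : nm (u n) * nm (u n - z) <= 1 * (K * nm p ^+ n).
    by apply: ler_pM; rewrite ?nm_ge0 // (le_trans (ub n)) // ltW.
  have B2 : nm (u n - z) * nm z <= 1 * (K * nm p ^+ n).
    by rewrite mulrC; apply: ler_pM; rewrite ?nm_ge0 // (le_trans zb) // ltW.
  have B3 : K * nm p ^+ n.+1 <= K * nm p ^+ n.
    rewrite exprS mulrCA -[leRHS]mul1r ler_wpM2r ?(ltW p1) //.
    by rewrite mulr_ge0 ?exprn_ge0 // divr_ge0 // subr_ge0 ltW.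
  by have := hz n.+1; lra.
- move=> c cp.
  have cu n : c * u n = u n * c.
    elim: n => [|n IH]; first by rewrite mulr0 mul0r.
    rewrite uS -scalerAl -scalerAr mulrDr mulrDl cp; congr (_ *: (_ + _)).
    by rewrite mulrA IH -mulrA IH mulrA.
  apply/eqP; rewrite -subr_eq0; apply/eqP.
  apply: (close _ (nm c + nm c)) => [|n]; first by rewrite addr_ge0 ?nm_ge0.
  have -> : c * z - z * c = (u n - z) * c - c * (u n - z).
    by rewrite mulrBl mulrBr cu; nc_ring R A.
  rewrite (le_trans (nmB _ _)) // [leRHS]mulrDl; apply: lerD; last exact: nmM.
  by rewrite mulrC nmM.
Qed.

Lemma spos_sqrt a : spos a -> exists k,
  [/\ spos k, k * k = a & forall c, c * a = a * c -> c * k = k * c].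
Proof.
move=> ha; have sa := spos_sa ha; have [T T0 hT] := spos_gt0 ha.
have Tn := rscV (lt0r_neq0 T0).
have rT : rsc (Num.sqrt T) * rsc (Num.sqrt T) = rsc T.
  by rewrite -rscM -expr2 sqr_sqrtr // ltW.
pose p := rsc T^-1 *: (rsc T *: 1 - a).
have sp : star p = p by rewrite starZr starB star_sc sa.
have np : nm p < 1.
  by rewrite nmZ gtr0_norm ?invr_gt0 // -ltr_pdivlMl ?invr_gt0 // invrK mulr1.
have [z [sz z1 zz zc]] := sqrt_one_minus sp np.
exists (rsc (Num.sqrt T) *: (1 - z)); split.
- apply: sposZ; first by rewrite sqrtr_gt0.
  by have := spos_bound sz z1; rewrite rsc1 scale1r.
- rewrite -scalerAl -scalerAr zz scalerA rT /p.
  by nc_ring R A; ring: Tn.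
- move=> c ca; have {}zc : c * z = z * c.
    apply: zc; rewrite /p -scalerAr -scalerAl mulrBr mulrBl ca.
    by nc_ring R A.
  by rewrite -scalerAr -scalerAl mulrBr mulrBl zc mulr1 mul1r.
Qed.

End StrictlyPositive.

Section PositiveElements.
Context {R : realType} {A : cstarAlgType R}.
Implicit Types (a b c h k m r s v w : A) (t e : R).

Lemma mulCii : 'i * 'i = -1 :> R[i].
Proof. by rewrite -expr2 sqrCi. Qed.

(* h + ik is normal with (h + ik)^* (h + ik) = h^2 + k^2. *)
Lemma nm_sumsq h k : star h = h -> star k = k -> h * k = k * h ->
  nm k ^+ 2 <= nm (h * h + k * k).
Proof.
move=> sh sk hk; pose u := h + 'i *: k.
have su : star u = h - 'i *: k by rewrite starD stariZ sh sk.
have <- : star u * u = h * h + k * k.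
  have -> : star u * u = h * h + k * k + 'i *: (h * k - k * h).
    by rewrite su /u; nc_ring R A; ring: mulCii.
  by rewrite hk subrr scaler0 addr0.
rewrite nm_starM ler_sqr ?nnegrE ?nm_ge0 //.
have : nm (rsc 2 *: ('i *: k)) <= nm u + nm u.
  rewrite -{2}(nm_star u) (_ : rsc 2 *: _ = u - star u) ?nmB //.
  by rewrite su /u; nc_ring R A.
by rewrite nmZ nmiZ ger0_norm //; lra.
Qed.

(** Take k with k^2 = T - h^2, which commutes with h. Then (T + e) - (h^2 + e) = k^2, and |k^2| =
    |k|^2 <= |h^2 + k^2| = T < T + e. *)
Lemma sqr_npos h : star h = h -> npos (h * h).
Proof.
move=> sh e e0; pose T := nm (h * h) + 1.
have hT : nm (h * h) < T by rewrite ltrDl.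
have sh2 : star (h * h) = h * h by rewrite starM sh.
have [k [/spos_sa sk kk kc]] := spos_sqrt (spos_bound sh2 hT).
have hk : h * k = k * h by apply: kc; nc_ring R A.
split; first by rewrite starD star_sc starM sh.
exists (T + e); have -> : rsc (T + e) *: 1 - (h * h + rsc e *: 1) = k * k.
  by rewrite rscD kk; nc_ring R A.
rewrite (nm_sa_sqr sk) (le_lt_trans (nm_sumsq sh sk hk)) // kk addrC subrK.
rewrite nm_sc ger0_norm ?ltrDl //.
by rewrite addr_ge0 ?nm_ge0.
Qed.

Lemma spos_mul_npos a b : spos a -> spos b -> a * b = b * a -> npos (a * b).
Proof.
move=> /spos_sqrt[k [/spos_sa sk kk kc]] /spos_sqrt[l [/spos_sa sl ll lc]] ab.
have kl : k * l = l * k by apply: lc; rewrite (kc b).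
have -> : a * b = (k * l) * (k * l).
  by rewrite -kk -ll !mulrA; congr (_ * _); rewrite -!mulrA kl.
by apply: sqr_npos; rewrite starM sk sl kl.
Qed.

Lemma npos_mul a b : npos a -> spos b -> a * b = b * a -> npos (a * b).
Proof.
(* Chosen so that d |b| < e, which makes e - d b strictly positive. *)
move=> ha hb ab e e0; pose d := e / (nm b + 1).
have b1 : 0 < nm b + 1 by rewrite ltr_wpDl ?nm_ge0.
have d0 : 0 < d by rewrite divr_gt0.
have -> : a * b + rsc e *: 1 =
    (a + rsc d *: 1) * b + (rsc e *: 1 - rsc d *: b) by nc_ring R A.
apply: npos_spos.
  apply: spos_mul_npos => //; first exact: ha.
  by rewrite mulrDl mulrDr ab; nc_ring R A.
apply: spos_bound; first by rewrite starZr (spos_sa hb).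
by rewrite nmZ gtr0_norm // /d mulrAC ltr_pdivrMr // mulrDr mulr1 ltrDl.
Qed.

(** If k^2 = w + e and l^2 = t - w + e, then k and l commute and |w + e| = |k|^2 <= |k^2 + l^2| = t
    + 2 e. Hence |w| <= t + 3 e, with e a third of the allowed error. *)
Lemma npos_norm w t : npos w -> npos (rsc t *: 1 - w) -> nm w <= t.
Proof.
move=> hw htw; apply/ler_addgt0Pr => d d0; pose e := d / 3.
have e0 : 0 < e by rewrite divr_gt0.
have [k [/spos_sa sk kk kc]] := spos_sqrt (hw e e0).
have [l [/spos_sa sl ll lc]] := spos_sqrt (htw e e0).
have kl : l * k = k * l.
  apply: kc; rewrite mulrDr mulrDl; congr (_ + _); last by nc_ring R A.
  by apply: esym; apply: lc; nc_ring R A.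
have := nm_sumsq sl sk kl; rewrite -nm_sa_sqr // kk ll.
have -> : rsc t *: 1 - w + rsc e *: 1 + (w + rsc e *: 1) =
   rsc (t + e + e) *: 1 by rewrite !rscD; nc_ring R A.
rewrite nm_sc => h.
have := nmB (w + rsc e *: 1) (rsc e *: 1); rewrite addrK nm_sc (gtr0_norm e0).
have : 0 <= t + e + e.
  have := sposD (hw e e0) (htw e e0).
  have -> : w + rsc e *: 1 + (rsc t *: 1 - w + rsc e *: 1) =
    rsc (t + e + e) *: 1 by rewrite !rscD; nc_ring R A.
  move=> /spos_gt0 [T T0 hT]; rewrite leNgt; apply/negP => te.
  move: hT; rewrite -scalerBl -[_ - _](rmorphB (real_complex R)) -/(rsc _) nm_sc.
  by rewrite ger0_norm; lra.
by move: h => /[swap] /ger0_norm ->; rewrite /e; lra.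
Qed.

(** For u = t + e, the element u^2 - w^2 factors into the commuting positive elements u + w and u -
    w; [npos_norm] then bounds |w^2| = |w|^2 by u^2. *)
Lemma npos_norm_sym w t : 0 <= t ->
  npos (rsc t *: 1 + w) -> npos (rsc t *: 1 - w) -> nm w <= t.
Proof.
move=> t0 hp hm; apply/ler_addgt0Pr => e e0; pose u := t + e.
have u0 : 0 < u by rewrite ltr_wpDl.
have sw : star w = w by have := npos_sa hp; rewrite starD star_sc => /addrI.
rewrite -ler_sqr ?nnegrE ?nm_ge0 ?(ltW u0) // -nm_sa_sqr //.
apply: npos_norm; first exact: sqr_npos.
have -> : rsc (u ^+ 2) *: 1 - w * w =
    (rsc t *: 1 + w + rsc e *: 1) * (rsc t *: 1 - w + rsc e *: 1).
  by rewrite /u expr2 rscM rscD; nc_ring R A.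
apply: spos_mul_npos; [exact: hp|exact: hm|by nc_ring R A].
Qed.

(** With w = v^-1, M > |w| and e = 1 / (4 M), the product (v + e) (M - w) of commuting positive
    elements equals M v - 3/4 - e w. So M v is a nonnegative element plus 3/4 + e w, where |e w| <
    1/4. *)
Lemma npos_unit v : npos v -> v \is a GRing.unit -> spos v.
Proof.
move=> hv uv; have sv := npos_sa hv; pose w := v^-1; pose M := nm w + 1.
have vw : v * w = 1 by rewrite divrr.
have wv : w * v = 1 by rewrite mulVr.
have sw : star w = w by rewrite star_inv // sv.
have M0 : 0 < M by rewrite ltr_wpDl ?nm_ge0.
have wM : nm w < M by rewrite ltrDl.
pose t : R := 4^-1; pose e := t * M^-1.
have e0 : 0 < e by rewrite mulr_gt0 ?invr_gt0.
have h1 : npos ((v + rsc e *: 1) * (rsc M *: 1 - w)).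
  apply: spos_mul_npos; [exact: hv|exact: spos_bound|].
  rewrite !mulrDl !mulrDr !mulrN !mulNr vw wv.
  by nc_ring R A.
have h2 : spos (rsc e *: (rsc M *: 1 + w)).
  apply: sposZ => //; rewrite -[w]opprK; apply: spos_bound; last by rewrite nmN.
  by rewrite starN sw.
have hM := rscV (lt0r_neq0 M0).
have h3 : spos (rsc M *: v).
  have -> : rsc M *: v = (v + rsc e *: 1) * (rsc M *: 1 - w)
      + (rsc e *: (rsc M *: 1 + w) + rsc (1 - (t + t)) *: 1).
    rewrite mulrBr !mulrDl vw.
    by rewrite /e rscM; nc_ring R A; ring: hM.
  by apply: npos_spos => //; apply: sposD => //; apply: spos_sc; rewrite /t; lra.
have -> : v = rsc M^-1 *: (rsc M *: v).
  by rewrite scalerA mulrC rscV ?gt_eqF // scale1r.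
by apply: sposZ; rewrite ?invr_gt0.
Qed.

End PositiveElements.

Section StarSquares.
Context {R : realType} {A : cstarAlgType R}.
Implicit Types (a b c d k m r s v w : A) (t e : R).

Lemma comm_inv a b : a \is a GRing.unit -> a * b = b * a -> a^-1 * b = b * a^-1.
Proof. by move=> ua ab; apply/esym; exact: (commrV (esym ab)). Qed.

Lemma spos_inv a : spos a -> spos a^-1.
Proof.
move=> ha; have [k [hk kk _]] := spos_sqrt ha; have uk := spos_unit hk.
have -> : a^-1 = k^-1 * k^-1 by rewrite -kk invrM.
apply: npos_unit; last by rewrite unitrMl ?unitrV.
by apply: sqr_npos; rewrite star_inv // (spos_sa hk).
Qed.

(* With k^2 = 2e + c c^* and q = k^-1 c one has q q^* = 1 - 2e k^-2, of norm at
   most 1, while 1 - q^* q is 2e times the inverse of 2e + c^* c. *)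
Lemma star_mul_swap c e : 0 < e -> npos (c * star c + rsc e *: 1) ->
  spos (star c * c + rsc (e + e) *: 1).
Proof.
move=> e0 hc; have hk := hc e e0; have e2 : 0 < e + e by rewrite addr_gt0.
set a := _ + _ in hk; have ea : a = c * star c + rsc (e + e) *: 1.
  by rewrite /a rscD; nc_ring R A.
have [k [/[dup] kp /spos_sa sk kk kc]] := spos_sqrt hk.
have uk := spos_unit kp; pose r := k^-1.
have rk : r * k = 1 by rewrite mulVr.
have kr : k * r = 1 by rewrite divrr.
have sr : star r = r by rewrite star_inv // sk.
have rrk : r * r * (c * star c) = 1 - rsc (e + e) *: (r * r).
  have -> : c * star c = k * k - rsc (e + e) *: 1 by rewrite kk ea addrK.
  rewrite mulrBr -!mulrA [r * (k * k)]mulrA rk mul1r rk.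
  by nc_ring R A.
have krr : c * star c * (r * r) = 1 - rsc (e + e) *: (r * r).
  have -> : c * star c = k * k - rsc (e + e) *: 1 by rewrite kk ea addrK.
  rewrite mulrBl -!mulrA [k * (r * r)]mulrA kr mul1r kr.
  by nc_ring R A.
have rcr : r * (c * star c) * r = 1 - rsc (e + e) *: (r * r).
  have -> : c * star c = k * k - rsc (e + e) *: 1 by rewrite kk ea addrK.
  rewrite mulrBr mulrBl -!mulrA kr mulr1 [in X in X - _]rk.
  by nc_ring R A.
have r2 : spos (r * r).
  apply: npos_unit; last by rewrite unitrMl ?unitrV.
  exact: sqr_npos.
pose q := r * c.
have sq : star q = star c * r by rewrite starM sr.
have qq : q * star q = 1 - rsc (e + e) *: (r * r).
  by rewrite sq /q -rcr !mulrA.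
(* Since c c^* is only known to be at least - e, a lower bound for q q^* is needed as well. The
   shift 2e in k^2 provides it: 1 + q q^* = 2 (c c^* + e) k^-2. *)
have nq : nm (q * star q) <= 1.
  apply: npos_norm_sym => //; rewrite rsc1 scale1r qq.
    have -> : 1 + (1 - rsc (e + e) *: (r * r)) =
        rsc 2 *: ((c * star c + rsc e *: 1) * (r * r)).
      by rewrite mulrDl krr rscD; nc_ring R A.
    apply: nposZ => //; apply: npos_mul => //.
    by rewrite mulrDl mulrDr rrk krr; nc_ring R A.
  rewrite subKr; apply: nposZ; first exact: ltW.
  exact: spos_npos.
(* The actual swap: by the C*-identity both norms are |q|^2. *)
have nq' : nm (star q * q) <= 1.
  by rewrite nm_starM -nm_star -nm_starM starK.
have sg : star (star q * q) = star q * q by rewrite starM starK.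
have g : npos (1 - star q * q).
  by have := npos_bound sg nq'; rewrite rsc1 scale1r.
set w := star c * c + _.
have sw : star w = w by rewrite starD starM starK star_sc.
have gw : (1 - star q * q) * w = rsc (e + e) *: 1.
  have h : star c * (r * r) * (c * star c) * c =
      star c * c - rsc (e + e) *: (star c * (r * r) * c).
    by rewrite -(mulrA (star c)) rrk; nc_ring R A.
  rewrite /w sq /q.
  transitivity (star c * c + rsc (e + e) *: 1
     - star c * (r * r) * (c * star c) * c
     - rsc (e + e) *: (star c * (r * r) * c)); first by nc_ring R A.
  by rewrite h; nc_ring R A.
have wg : w * (1 - star q * q) = rsc (e + e) *: 1.
  by rewrite -[LHS]starK starM starB star1 sg sw gw star_sc.
have ee := rscV (lt0r_neq0 e2).
have ug : 1 - star q * q \is a GRing.unit.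
  apply/unitrP; exists (rsc (e + e)^-1 *: w); split.
    by rewrite -scalerAl wg scalerA mulrC ee scale1r.
  by rewrite -scalerAr gw scalerA mulrC ee scale1r.
have -> : w = rsc (e + e) *: (1 - star q * q)^-1.
  by rewrite -[LHS](mulrK ug) wg -scalerAl mul1r.
by apply: sposZ => //; apply: spos_inv; exact: npos_unit.
Qed.

(* If v = c^* c, s = (v^2 + d^2)^(1/2) and m = s - v, then D = c m satisfies
   D^* D = (d^2 m - m^3) / 2, and D D^* + D^* D is a sum of squares; swapping
   bounds m^3, hence the negative part of v. *)
Lemma star_mul_npos c : npos (star c * c).
Proof.
set v := star c * c; have sv : star v = v by rewrite starM starK.
suff H (d : R) : 0 < d -> spos (v + rsc (d + d) *: 1).
  move=> e e0; have := H (e / 2) (divr_gt0 e0 (ltr0n _ 2)).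
  by rewrite (_ : e / 2 + e / 2 = e) //; field.
move=> d0; have d2 : 0 < d * d by rewrite mulr_gt0.
have [s [/[dup] ps /spos_sa ss s2 sc]] := spos_sqrt (sqr_npos sv d2).
have vs : v * s = s * v by apply: sc; nc_ring R A.
(* Twice the negative part of v, smoothed by d so that it is invertible: m (s + v) = d^2. *)
pose m := s - v; have sm : star m = m by rewrite starB ss sv.
have mD : m * (s + v) = rsc (d * d) *: 1.
  transitivity (s * s - v * v + (s * v - v * s)); first by rewrite /m; nc_ring R A.
  by rewrite s2 vs; nc_ring R A.
have Dm : (s + v) * m = rsc (d * d) *: 1.
  by rewrite -[LHS]starK starM starD ss sv sm mD star_sc.
have dd := rscV (lt0r_neq0 d2).
have um : m \is a GRing.unit.
  apply/unitrP; exists (rsc (d * d)^-1 *: (s + v)); split.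
    by rewrite -scalerAl Dm scalerA mulrC dd scale1r.
  by rewrite -scalerAr mD scalerA mulrC dd scale1r.
have ms : m * s = s * m by rewrite /m mulrBl mulrBr vs.
have us := spos_unit ps.
have pm : spos m.
  apply: npos_unit => //.
  have -> : m = rsc 2^-1 *: ((m * m + rsc (d * d) *: 1) * s^-1).
    have -> : m * m + rsc (d * d) *: 1 = rsc 2 *: (m * s).
      by rewrite -mD /m; nc_ring R A.
    by rewrite -scalerAl mulrK // scalerA mulrC rscV // scale1r.
  apply: nposZ; first by rewrite invr_ge0.
  apply: npos_mul; [apply: spos_npos; exact: sqr_npos|exact: spos_inv|].
  apply: esym; apply: comm_inv => //.
  have mms : m * m * s = s * (m * m) by rewrite -mulrA ms mulrA ms -mulrA.
  rewrite [LHS]mulrDr [RHS]mulrDl -mms.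
  by nc_ring R A.
pose mu := nm m.
have mu0 : 0 < mu.
  rewrite lt0r nm_ge0 andbT; apply/eqP => /nm_eq0 m0.
  by move: um; rewrite m0 unitr0.
have m3 : npos (m * m * m).
  by apply: npos_mul; [exact: sqr_npos| |rewrite mulrA].
have mv : m * v = rsc 2^-1 *: (rsc (d * d) *: 1 - m * m).
  rewrite -mD (_ : m * (s + v) - m * m = rsc 2 *: (m * v)).
    by rewrite scalerA mulrC rscV // scale1r.
  by rewrite /m; nc_ring R A.
pose D := c * m.
have DD : star D * D = rsc 2^-1 *: (rsc (d * d) *: m - m * m * m).
  rewrite starM sm; transitivity (m * v * m); first by rewrite /v /D; nc_ring R A.
  by rewrite mv; nc_ring R A.
(* D^* D lies below h, because m <= mu and m^3 >= 0. As D D^* + D^* D >= 0, it follows that D D^* >=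
   - h, the hypothesis of the swap. *)
pose h := d * d * mu / 2; have h0 : 0 < h by rewrite divr_gt0 // mulr_gt0.
have hmu : rsc h = rsc 2^-1 * (rsc (d * d) * rsc mu).
  by rewrite /h rscM mulrC rscM.
have hmm : npos (rsc mu *: 1 - m) by apply: npos_bound.
have hd2 : 0 <= d * d by exact: ltW.
have H1 : npos (D * star D + rsc h *: 1).
  pose a := D + star D; pose b := 'i *: (D - star D).
  have sa : star a = a by rewrite starD starK addrC.
  have sb : star b = b by rewrite stariZ starB starK -scalerN opprB.
  have hab : a * a + b * b = rsc 2 *: (D * star D + star D * D).
    by rewrite /a /b; nc_ring R A; ring: (mulCii (R := R)).
  have -> : D * star D + rsc h *: 1 = rsc 2^-1 *: (a * a + b * b)
      + rsc 2^-1 *: (m * m * m + rsc (d * d) *: (rsc mu *: 1 - m)).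
    rewrite hab scalerA [rsc _^-1 * _]mulrC rscV // scale1r DD hmu.
    by nc_ring R A.
  have half0 : 0 <= 2^-1 :> R by rewrite invr_ge0.
  apply: nposD; apply: nposZ => //; first by apply: nposD; exact: sqr_npos.
  by apply: nposD => //; exact: nposZ.
have H2 := spos_npos (star_mul_swap h0 H1).
(* The swap gives D^* D >= - 2 h = - d^2 mu, that is, m^3 <= d^2 m + 2 d^2 mu <= 3 d^2 mu. *)
have H3 : nm (m * m * m) <= 3 * (d * d) * mu.
  apply: npos_norm => //.
  have -> : rsc (3 * (d * d) * mu) *: 1 - m * m * m =
     rsc 2 *: (star D * D + rsc (h + h) *: 1) + rsc (d * d) *: (rsc mu *: 1 - m).
    rewrite DD (_ : rsc (h + h) = rsc (d * d) * rsc mu); last first.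
      by rewrite -rscM /h; congr rsc; field.
    rewrite (_ : rsc (3 * (d * d) * mu) = 3%:R * rsc (d * d) * rsc mu); last first.
      by rewrite !rscM; congr (_ * _ * _); exact: rmorph_nat.
    rewrite (scalerDr (rsc 2)) scalerA rscV // scale1r.
    by nc_ring R A.
  by apply: nposD; exact: nposZ.
(* From mu^4 = |m^4| <= |m^3| |m| <= 3 d^2 mu^2. As 3 < 4, this puts mu below 2 d. *)
have H4 : mu ^+ 2 <= 3 * (d * d).
  have : mu ^+ 2 * mu ^+ 2 <= 3 * (d * d) * (mu ^+ 2).
    rewrite -expr2 /mu -(nm_sa_sqr sm) -nm_sa_sqr; last by rewrite starM sm.
    rewrite (_ : m * m * (m * m) = m * m * m * m); last by rewrite !mulrA.
    rewrite (le_trans (nmM _ _)) // (nm_sa_sqr sm) expr2 [leRHS]mulrA.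
    by apply: ler_wpM2r; [exact: nm_ge0|exact: H3].
  by rewrite ler_pM2r // exprn_gt0.
have H5 : mu < d + d by rewrite -ltr_sqr ?nnegrE; nra.
have -> : v + rsc (d + d) *: 1 = s + (rsc (d + d) *: 1 - m).
  by rewrite /m; nc_ring R A.
by apply: sposD => //; exact: spos_bound.
Qed.

Lemma positive_npos a : positive a -> npos a.
Proof. by case=> c ->; exact: star_mul_npos. Qed.

Lemma spos_positive a : spos a -> positive a.
Proof.
by move=> /spos_sqrt[k [/spos_sa sk <- _]]; exists k; rewrite sk.
Qed.

Lemma spos_sandwich d r : spos d -> r \is a GRing.unit -> spos (star r * d * r).
Proof.
move=> hd ur; apply: npos_unit; last first.
  by rewrite unitrMl // unitrMr ?unit_star // spos_unit.
have [k [/spos_sa sk <- _]] := spos_sqrt hd.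
have -> : star r * (k * k) * r = star (k * r) * (k * r).
  by rewrite starM sk !mulrA.
exact: star_mul_npos.
Qed.

End StarSquares.

(** * The operator upper half-plane *)

Section HalfPlane.
Context {R : realType} {A : cstarAlgType R}.
Implicit Types (a b r u v : A) (t e : R) (V : set A).

Lemma im_partE a : rsc 2 *: ('i *: im_part a) = a - star a.
Proof.
have i0 : 'i != 0 :> R[i] by exact: neq0Ci.
rewrite /im_part !scalerA (_ : rsc 2 = 2%:R); last exact: rmorph_nat.
by rewrite divff ?scale1r // mulf_neq0 // pnatr_eq0.
Qed.

Lemma im_partP a v : a - star a = rsc 2 *: ('i *: v) -> im_part a = v.
Proof.
have i0 : 'i != 0 :> R[i] by exact: neq0Ci.
move=> h; rewrite /im_part h !scalerA (_ : rsc 2 = 2%:R); last exact: rmorph_nat.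
by rewrite -mulrA mulVf ?scale1r // mulf_neq0 // pnatr_eq0.
Qed.

Lemma im_part_sa a : star (im_part a) = im_part a.
Proof.
rewrite /im_part starZ starB starK fmorphV rmorphM /= conjCi rmorph_nat.
by rewrite mulrN invrN scaleNr -scalerN opprB.
Qed.

Lemma nm_im_part a : nm (im_part a) <= nm a.
Proof.
have := nmB a (star a); rewrite -im_partE nmZ nmiZ nm_star ger0_norm //.
by lra.
Qed.

Lemma upper_half_plane_spos a : upper_half_plane a -> spos (im_part a).
Proof. by case=> /positive_npos; exact: npos_unit. Qed.

(* For large T, |a - iT| < T, so a^-1 is given by a Neumann series in a - iT. *)
Lemma im_spos_inv a : spos (im_part a) -> a \is a GRing.unit /\
  forall V, closed_subspace V -> V 1 -> (forall v, V v -> V (a * v)) -> V a^-1.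
Proof.
set v := im_part a => hv; have sv := spos_sa hv.
pose u := a - 'i *: v.
have su : star u = u.
  rewrite /u starB stariZ sv opprK -[X in _ = X - _](subrK (star a) a).
  by rewrite -im_partE -/v; nc_ring R A.
have [e [T0 [e0 eT hT]]] := spos_large hv.
pose C := nm (u * u + 'i *: (u * v - v * u)); have C0 : 0 <= C := nm_ge0 _.
(* The real and imaginary parts u, v of a need not commute, hence the term C. As |d|^2 <= C + (T -
   e)^2, the bound |d| < T follows once C + e^2 < 2 T e. *)
pose T := T0 + (C + e * e + 1) / e.
have hTe : T * e = T0 * e + C + e * e + 1.
  by rewrite /T; field; rewrite gt_eqF.
have T0T : T0 <= T by rewrite lerDl divr_ge0 ?(ltW e0) //; nra.
have Tp : 0 < T by apply: lt_le_trans e0 _; apply: le_trans T0T.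
move: {hT}(hT T T0T) => hT.
pose w := rsc T *: 1 - v; have sw : star w = w by rewrite starB star_sc sv.
pose d := u - 'i *: w.
have dd : star d * d = (u * u + 'i *: (u * v - v * u)) + w * w.
  rewrite /d starB stariZ su sw opprK /w.
  by nc_ring R A; ring: (mulCii (R := R)).
have nd : nm d < T.
  rewrite -ltr_sqr ?nnegrE ?nm_ge0 ?(ltW Tp) // -nm_starM dd.
  apply: le_lt_trans (nmD _ _) _; rewrite -/C (nm_sa_sqr sw).
  have : nm w ^+ 2 <= (T - e) ^+ 2.
    by rewrite ler_sqr ?nnegrE ?nm_ge0 // (le_trans (nm_ge0 _) hT).
  by nra.
have Tn := rscV (lt0r_neq0 Tp).
pose p := (rsc T^-1 * 'i) *: d.
have [|q [q1 q2 qV]] := @neumann R A p.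
  rewrite /p -scalerA nmZ nmiZ gtr0_norm ?invr_gt0 //.
  by rewrite -ltr_pdivlMl ?invr_gt0 // invrK mulr1.
have ad : a = u + 'i *: v by rewrite /u subrK.
have dE : d = a - (rsc T * 'i) *: 1.
  by rewrite ad /d /w; nc_ring R A.
have pE : 1 - p = - ((rsc T^-1 * 'i) *: a).
  by rewrite /p dE; nc_ring R A; ring: (mulCii (R := R)) Tn.
have ra : a * (- ((rsc T^-1 * 'i) *: q)) = 1.
  by rewrite -q1 pE; nc_ring R A.
have la : - ((rsc T^-1 * 'i) *: q) * a = 1.
  by rewrite -q2 pE; nc_ring R A.
have ua : a \is a GRing.unit by apply/unitrP; exists (- ((rsc T^-1 * 'i) *: q)).
split => // V cV V1 Va.
have Vl := cV.1; have V0 : V 0 by have := Vl (-1) 1 1 V1 V1; rewrite scaleN1r addNr.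
have VZ k b : V b -> V (k *: b) by move=> Vb; have := Vl k b 0 Vb V0; rewrite addr0.
have -> : a^-1 = - ((rsc T^-1 * 'i) *: q) by rewrite -[RHS](mulKr ua) ra mulr1.
rewrite -scaleNr; apply: (VZ); apply: qV => // b Vb.
have -> : p * b = (rsc T^-1 * 'i) *: (- (rsc T * 'i) *: b + a * b).
  by rewrite /p dE; nc_ring R A.
by apply: VZ; apply: Vl => //; exact: Va.
Qed.

Lemma im_part_oppV a : a \is a GRing.unit ->
  im_part (- a^-1) = star a^-1 * im_part a * a^-1.
Proof.
move=> ua; apply: im_partP; rewrite starN.
have -> : rsc 2 *: ('i *: (star a^-1 * im_part a * a^-1)) =
    star a^-1 * (rsc 2 *: ('i *: im_part a)) * a^-1 by nc_ring R A.
rewrite im_partE mulrBr mulrBl -mulrA divrr // mulr1.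
by rewrite -starM divrr // star1 mul1r; nc_ring R A.
Qed.

Lemma im_spos_oppV a : spos (im_part a) -> spos (im_part (- a^-1)).
Proof.
move=> ha; have [ua _] := im_spos_inv ha.
by rewrite im_part_oppV //; apply: spos_sandwich; rewrite ?unitrV.
Qed.

End HalfPlane.

(** * Positivity and boundedness of E and E', and the F-transform *)

Section ConditionalExpectation.
Context {R : realType} {A B : cstarAlgType R}.
Implicit Types (a x : A) (b : B).

Lemma cp_positive (f : A -> B) a :
  completely_positive f -> positive a -> positive (f a).
Proof.
move=> hf [c ac]; have [|Y hY] := hf 1%N (const_mx a).
  exists (const_mx c); apply/matrixP => i j.
  by rewrite !mxE big_ord1 !mxE ac.
exists (Y 0 0); have /matrixP/(_ 0 0) := hY.
by rewrite !mxE big_ord1 !mxE.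
Qed.

(** The [cstar_mx_norm] of a 1 x 1 matrix is the norm of its entry, the supremum being attained at v
    = 1; so the case n = 1 is ordinary boundedness. *)
Lemma cb_bounded (f : A -> B) :
  completely_bounded f -> exists M, forall a, nm (f a) <= M * nm a.
Proof.
move=> [M hM]; exists M => a.
have hn (D : cstarAlgType R) (v : 'cV[D]_1) : hilbert_norm v = nm (v 0 0).
  rewrite /hilbert_norm !mxE big_ord1 !mxE -/(nm _) nm_starM sqrtr_sqr.
  by rewrite ger0_norm ?nm_ge0.
have cn (D : cstarAlgType R) (d : D) : cstar_mx_norm (const_mx d : 'M[D]_1) = nm d.
  rewrite /cstar_mx_norm; set S := (X in sup X).
  have ubS : ubound S (nm d).
    move=> _ [v /= hv <-]; move: hv; rewrite !hn !mxE big_ord1 !mxE => hv.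
    by rewrite (le_trans (nmM _ _)) // ler_piMr ?nm_ge0.
  have Sd : S (nm d).
    exists (const_mx 1); first by rewrite /= hn mxE nm1.
    by rewrite hn !mxE big_ord1 !mxE mulr1.
  apply/eqP; rewrite eq_le; apply/andP; split; first by apply: ge_sup ubS; exists (nm d).
  by apply: ub_le_sup => //; exists (nm d).
rewrite -[nm (f a)]cn -[nm a]cn; have := hM 1%N (const_mx a).
suff -> : map_mx f (const_mx a : 'M[A]_1) = const_mx (f a) by [].
by apply/matrixP => i j; rewrite !mxE.
Qed.

End ConditionalExpectation.

Section ProbabilitySpace.
Context {R : realType} {A B : cstarAlgType R}.
Context (iota : {lrmorphism B -> A}) (E E' : {linear A -> B}).
Context (hspace : cstar_inf_prob_space iota E E').
Implicit Types (a x : A) (b : B) (t e : R).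

Lemma iota_star b : iota (star b) = star (iota b).
Proof. exact: (inclusion_star (ips_inclusion hspace)). Qed.

Lemma nm_iota b : nm (iota b) = nm b.
Proof. by rewrite /nm (inclusion_norm (ips_inclusion hspace)). Qed.

Lemma iota_sc t : iota (rsc t *: 1) = rsc t *: 1.
Proof. by rewrite linearZ /= rmorph1. Qed.

Lemma E_iotal b a : E (iota b * a) = b * E a.
Proof. by have := ips_E_bimod hspace b a 1; rewrite rmorph1 !mulr1. Qed.

Lemma E_iotar a b : E (a * iota b) = E a * b.
Proof. by have := ips_E_bimod hspace 1 a b; rewrite rmorph1 !mul1r. Qed.

Lemma E_sc t : E (rsc t *: 1) = rsc t *: 1.
Proof. by rewrite -iota_sc (ips_E_id hspace). Qed.

Lemma E_positive a : spos a -> npos (E a).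
Proof.
move=> /spos_positive/(cp_positive (ips_E_cp hspace)); exact: positive_npos.
Qed.

Lemma E_sa a : star a = a -> star (E a) = E a.
Proof.
move=> sa; have : nm a < nm a + 1 by rewrite ltrDl.
move=> /(spos_bound sa) /E_positive /npos_sa.
by rewrite raddfB /= E_sc starB star_sc => /addrI /oppr_inj.
Qed.

Lemma E_star a : E (star a) = star (E a).
Proof.
have h : E (a + star a) = star (E (a + star a)).
  by rewrite E_sa // starD starK addrC.
have h' : E ('i *: (a - star a)) = star (E ('i *: (a - star a))).
  by rewrite E_sa // stariZ starB starK -scalerN opprB.
move: h h'; rewrite !linearZ /= raddfD raddfB /= stariZ starD starB.
move: (E a) (E (star a)) => u v h h'.
have {}h' : u - v = - (star u - star v).
  apply: (scalerI (neq0Ci R[i])); rewrite h'.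
  by rewrite scalerN.
have two : rsc 2 *: v = rsc 2 *: star u.
  have -> : rsc 2 *: v = (u + v) - (u - v) by nc_ring R B.
  by rewrite h h'; nc_ring R B.
by move: two => /scalerI; apply; rewrite (_ : rsc 2 = 2%:R) ?pnatr_eq0 //; exact: rmorph_nat.
Qed.

(** A variance identity: for t > |a|, t^2 - E(a)^* E(a) is the sum of E(t^2 - a^* a) and E((a -
    E(a))^* (a - E(a))), both nonnegative. *)
Lemma E_contractive a : nm (E a) <= nm a.
Proof.
apply/ler_addgt0Pr => e e0; pose t := nm a + e.
have at_ : nm a < t by rewrite ltrDl.
have t0 : 0 < t by exact: le_lt_trans (nm_ge0 _) at_.
have sq : star (E a) * E a = E (star a * iota (E a)).
  by rewrite E_iotar E_star.
rewrite -ler_sqr ?nnegrE ?nm_ge0 ?(ltW t0) // -nm_starM.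
apply: npos_norm; first exact: star_mul_npos.
have -> : rsc (t ^+ 2) *: 1 - star (E a) * E a =
   E (rsc (t ^+ 2) *: 1 - star a * a)
   + E (star (a - iota (E a)) * (a - iota (E a))).
  rewrite -raddfD /= starB -iota_star !mulrBr !mulrBl.
  have -> : rsc (t ^+ 2) *: 1 - star a * a + (star a * a - iota (star (E a)) * a -
    (star a * iota (E a) - iota (star (E a)) * iota (E a))) =
    rsc (t ^+ 2) *: 1 - iota (star (E a)) * a - star a * iota (E a) +
      iota (star (E a)) * iota (E a) by nc_ring R A.
  rewrite raddfD /= !raddfB /= E_sc !E_iotal !E_iotar E_star.
  by rewrite (ips_E_id hspace); nc_ring R B.
apply: nposD.
  apply: E_positive; apply: spos_bound; first by rewrite starM starK.
  by rewrite nm_starM ltr_sqr ?nnegrE ?nm_ge0 ?(ltW t0).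
apply: positive_npos; apply: (cp_positive (ips_E_cp hspace)).
by exists (a - iota (E a)).
Qed.

Lemma E'_bounded : exists M, forall a, nm (E' a) <= M * nm a.
Proof. exact: (cb_bounded (ips_E'_cb hspace)). Qed.

Lemma spos_iota b : spos b -> spos (iota b).
Proof.
move=> [sb [T hT]]; split; first by rewrite -iota_star sb.
by exists T; rewrite -iota_sc -raddfB nm_iota.
Qed.

Lemma spos_E a : spos a -> spos (E a).
Proof.
move=> [sa [T hT]]; split; first by rewrite -E_star sa.
by exists T; rewrite -E_sc -raddfB (le_lt_trans (E_contractive _)).
Qed.

Lemma im_part_iota_sub b x : star x = x -> im_part (iota b - x) = iota (im_part b).
Proof.
move=> sx; apply: im_partP; rewrite starB sx -iota_star.
have -> : rsc 2 *: ('i *: iota (im_part b)) = iota (b - star b).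
  by rewrite -im_partE !linearZ /=; nc_ring R A.
by rewrite rmorphB /= opprB addrA subrK.
Qed.

Lemma im_part_E a : im_part (E a) = E (im_part a).
Proof.
apply: im_partP; rewrite -E_star -raddfB /= -(im_partE a) !linearZ /=.
by nc_ring R B.
Qed.

(** F = - (E (- (b - y)^-1))^-1, and both a |-> - a^-1 and E keep the imaginary part strictly
    positive. *)
Lemma im_spos_F y b : star y = y -> spos (im_part b) ->
  spos (im_part (F_transform iota E y b)).
Proof.
move=> sy hb; have h : spos (im_part (iota b - y)).
  by rewrite im_part_iota_sub //; exact: spos_iota.
have := spos_E (im_spos_oppV h); rewrite -im_part_E raddfN => /im_spos_oppV.
by rewrite invrN opprK.
Qed.

Lemma G_unit y b : star y = y -> spos (im_part b) ->
  cauchy_transform iota E y b \is a GRing.unit.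
Proof.
move=> sy /(im_spos_F sy) /im_spos_inv [+ _].
by rewrite /F_transform unitrV.
Qed.

End ProbabilitySpace.

(** * The derivative of the Cauchy transform *)

Section FrechetDerivative.
Context {R : realType} {A B : cstarAlgType R}.

(** The candidate for the derivative of the Cauchy transform, named so that it can carry the linear
    structure with which [diff_unique] identifies it. *)
Definition sandwich (iota : {lrmorphism B -> A}) (E : {linear A -> B})
  (q : A) (h : B) : B := - E (q * iota h * q).

Fact sandwich_is_linear iota E q : linear (sandwich iota E q).
Proof.
move=> k u v; rewrite /sandwich linearP /= mulrDr mulrDl -scalerAr -scalerAl.
by rewrite linearP /= opprD scalerN.
Qed.

HB.instance Definition _ iota E q := GRing.isLinear.Build R[i] B B *:%R
  (sandwich iota E q) (sandwich_is_linear iota E q).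

Context (iota : {lrmorphism B -> A}) (E E' : {linear A -> B}).
Context (hspace : cstar_inf_prob_space iota E E').

Lemma nbhs_nm (c : B) (P : B -> Prop) (e : R) : 0 < e ->
  (forall b, nm (c - b) < e -> P b) -> \forall b \near c, P b.
Proof.
move=> e0 h; apply/nbhs_ballP; exists (rsc e) => /=; first by rewrite ltcR.
by move=> b; rewrite -ball_normE /= nmE ltcR; exact: h.
Qed.

Lemma sandwich_continuous q : continuous (sandwich iota E q).
Proof.
move=> c; apply/cvgrPdist_lt => e e0.
have /complex_realP[r re] : e \is Num.real by rewrite gtr0_real.
have r0 : 0 < r by rewrite re ltcR in e0.
have M0 : 0 < nm q * nm q + 1 by rewrite ltr_wpDl ?mulr_ge0 ?nm_ge0.
apply: (@nbhs_nm _ _ (r / (nm q * nm q + 1))); first by rewrite divr_gt0.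
move=> b hb; rewrite nmE re ltcR -linearB /sandwich nmN.
apply: le_lt_trans (E_contractive hspace _) _.
have := nmM (q * iota (c - b)) q; have := nmM q (iota (c - b)).
rewrite (nm_iota hspace) => h1 h2.
have h3 : nm (q * iota (c - b)) * nm q <= nm q * nm (c - b) * nm q.
  by rewrite ler_wpM2r ?nm_ge0.
apply: (le_lt_trans (le_trans h2 h3)).
move: hb; rewrite ltr_pdivlMr //; have := nm_ge0 (c - b); nra.
Qed.

Lemma spos_im_near (c : B) : spos (im_part c) ->
  exists2 e, 0 < e & forall h, nm h < e -> spos (im_part (h + c)).
Proof.
move=> /spos_shift[e e0 he]; exists e => // h hh.
have -> : im_part (h + c) =
    (im_part c - rsc e *: 1) + (rsc e *: 1 - im_part (- h)).
  rewrite /im_part starD starN.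
  by nc_ring R B.
apply: sposD => //; apply: spos_bound; first exact: im_part_sa.
by rewrite (le_lt_trans (nm_im_part _)) // nmN.
Qed.

Lemma diff_cauchy_transform (x : A) (c h : B) : star x = x -> spos (im_part c) ->
  'd (cauchy_transform iota E x) c h =
    - E ((iota c - x)^-1 * iota h * (iota c - x)^-1).
Proof.
move=> sx hc; set q := (iota c - x)^-1.
have unit_at b : spos (im_part b) -> iota b - x \is a GRing.unit.
  move=> hb; have : spos (im_part (iota b - x)).
    by rewrite (im_part_iota_sub hspace) //; exact: (spos_iota hspace).
  by move=> /im_spos_inv[].
suff -> : 'd (cauchy_transform iota E x) c = sandwich iota E q :> (B -> B) by [].
apply: diff_unique; first exact: sandwich_continuous.
apply/eqaddoP => e e0.
have /complex_realP[r re] : e \is Num.real by rewrite gtr0_real.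
have r0 : 0 < r by rewrite re ltcR in e0.
have [d d0 hd] := spos_im_near hc.
pose n := nm q; have n0 : 0 <= n := nm_ge0 q.
(* The three bounds keep b + c in the half-plane, give |s| <= 2 n, and make the remainder, which is
   at most 2 n^3 |b|^2, at most r |b|. *)
pose d' := Num.min d (Num.min (2 * (n + 1))^-1 (r / (2 * n ^+ 3 + 1))).
have M0 : 0 < 2 * n ^+ 3 + 1 by rewrite ltr_wpDl // mulr_ge0 // exprn_ge0.
have N0 : 0 < 2 * (n + 1) by rewrite mulr_gt0 // ltr_wpDl.
have d'0 : 0 < d' by rewrite !lt_min d0 invr_gt0 N0 divr_gt0.
apply: (@nbhs_nm _ _ d') => // b; rewrite sub0r nmN !lt_min.
move=> /and3P[bd bn br].
rewrite !fctE /= /shift /=.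
pose s := (iota (b + c) - x)^-1.
have us := unit_at _ (hd b bd); have uq := unit_at _ hc.
have sE : s = q - q * iota b * s.
  have -> : q * iota b * s = q * (iota (b + c) - x - (iota c - x)) * s.
    rewrite rmorphD /=; congr (_ * _ * _).
    by rewrite opprB addrA subrK addrK.
  rewrite mulrBr mulrBl -(mulrA q (_ - x) s) divrr // mulr1.
  by rewrite /q mulVr // mul1r subKr.
have ns : nm s <= 2 * n.
  have := nmB q (q * iota b * s); rewrite -sE.
  have := nmM (q * iota b) s; have := nmM q (iota b).
  rewrite (nm_iota hspace) -/n => h1 h2 h3.
  have h4 : n * nm b <= 2^-1.
    move: bn; rewrite -div1r ltr_pdivlMr // => bn.
    by have := nm_ge0 b; nra.
  have h5 : nm (q * iota b) * nm s <= 2^-1 * nm s.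
    by rewrite ler_wpM2r ?nm_ge0 // (le_trans h1).
  by lra.
(* The resolvent identity inserted into itself: s = q - q b q + q b q b s, with a remainder of
   second order in b. *)
have rem : E s - (E q + sandwich iota E q b) = E (q * iota b * q * iota b * s).
  rewrite /sandwich -raddfB /= -raddfB /=; congr (E _).
  by rewrite {1}sE {1}sE; nc_ring R A.
rewrite /cauchy_transform -/q -/s rem !nmE re /rsc -rmorphM lecR.
apply: le_trans (E_contractive hspace _) _.
have nb := nm_ge0 b; have nsp := nm_ge0 s.
have h1 := nmM (q * iota b * q * iota b) s.
have h2 := nmM (q * iota b * q) (iota b).
have h3 := nmM (q * iota b) q.
have h4 := nmM q (iota b).
rewrite (nm_iota hspace) in h2 h4; rewrite -/n in h3 h4.
have {}h3 : nm (q * iota b * q) <= n * nm b * n by rewrite (le_trans h3) ?ler_wpM2r.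
have {}h2 : nm (q * iota b * q * iota b) <= n * nm b * n * nm b.
  by rewrite (le_trans h2) ?ler_wpM2r.
apply: (le_trans h1).
apply: (@le_trans _ _ (n * nm b * n * nm b * (2 * n))).
  by apply: ler_pM; rewrite ?nm_ge0.
move: br; rewrite ltr_pdivlMr // => br.
have -> : n * nm b * n * nm b * (2 * n) = (nm b * (2 * n ^+ 3)) * nm b by ring.
by rewrite ler_wpM2r //; nra.
Qed.

End FrechetDerivative.

(** * Extension of independence to closures *)

Section Closure.
Context {R : realType}.

Lemma closed_subspace_preimage (A D : cstarAlgType R) (f : A -> D) (V : set D) :
  (forall k a b, f (k *: a + b) = k *: f a + f b) ->
  (exists C, forall a, nm (f a) <= C * nm a) ->
  closed_subspace V -> closed_subspace (f @^-1` V).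
Proof.
move=> fl [C hC] [Vl Vc]; split=> [k a b /= Va Vb|z hz /=].
  by rewrite fl; exact: Vl.
have fB a b : f (a - b) = f a - f b.
  by rewrite -[a - b]addrC -scaleN1r fl scaleN1r addrC.
apply: Vc => e e0; have C0 : 0 < `|C| + 1 by rewrite ltr_wpDl.
have [s sV hs] := hz _ (divr_gt0 e0 C0).
exists (f s) => //; rewrite -fB (le_lt_trans (hC _)) //.
move: hs; rewrite ltr_pdivlMr //; have := nm_ge0 (z - s).
by have := ler_norm C; nra.
Qed.

Lemma closed_subspace0 (A : cstarAlgType R) : closed_subspace [set (0 : A)].
Proof.
split=> [k a b /= -> ->|z hz /=]; first by rewrite scaler0 addr0.
apply: nm_eq0; apply/eqP; rewrite eq_le nm_ge0 andbT.
apply/ler_addgt0Pr => e e0; rewrite add0r.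
by have [s /= ->] := hz e e0; rewrite subr0 => /ltW.
Qed.

Lemma closed_subspaceI (A : cstarAlgType R) (I : Type) (V : I -> set A) :
  (forall i, closed_subspace (V i)) -> closed_subspace [set a | forall i, V i a].
Proof.
move=> hV; split=> [k a b /= ha hb i|z hz i]; first by apply: (hV i).1.
apply: (hV i).2 => e e0; have [s hs zs] := hz e e0.
by exists s => //; exact: hs.
Qed.

Context {A : cstarAlgType R}.
Implicit Types (a b z : A) (S V : set A).

Definition norm_closure S : set A :=
  [set z | forall e : R, 0 < e -> exists2 s, S s & nm (z - s) < e].

Lemma sub_norm_closure S : S `<=` norm_closure S.
Proof. by move=> a Sa e e0; exists a => //; rewrite subrr nm0. Qed.

Lemma norm_closure_sub S V :
  closed_subspace V -> S `<=` V -> norm_closure S `<=` V.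
Proof.
move=> [_ Vc] SV z hz; apply: Vc => e e0.
by have [s /SV sV zs] := hz e e0; exists s.
Qed.

Lemma norm_closure_closed S :
  (forall k a b, S a -> S b -> S (k *: a + b)) -> closed_subspace (norm_closure S).
Proof.
move=> Sl; split=> [k a b ha hb e e0|z hz e e0].
  pose c := nm (k *: 1 : A); have c0 : 0 < c + 1 by rewrite ltr_wpDl ?nm_ge0.
  have e2 : 0 < e / 2 by rewrite divr_gt0.
  have [s Ss hs] := ha _ (divr_gt0 e2 c0); have [t St ht] := hb _ e2.
  exists (k *: s + t); first exact: Sl.
  have -> : k *: a + b - (k *: s + t) = (k *: 1) * (a - s) + (b - t).
    by nc_ring R A.
  have := nmD ((k *: 1) * (a - s)) (b - t); have := nmM (k *: 1) (a - s).
  move: hs; rewrite ltr_pdivlMr // -/c; have := nm_ge0 (a - s); nra.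
have e2 : 0 < e / 2 by rewrite divr_gt0.
have [s hs zs] := hz _ e2; have [t St st] := hs _ e2.
by exists t => //; have := nm_trans s z t; lra.
Qed.

Lemma norm_closure_mul S :
  (forall k a b, S a -> S b -> S (k *: a + b)) ->
  (forall a b, S a -> S b -> S (a * b)) ->
  forall a b, norm_closure S a -> norm_closure S b -> norm_closure S (a * b).
Proof.
move=> Sl Sm; have cS := norm_closure_closed Sl.
have H s b : S s -> norm_closure S b -> norm_closure S (s * b).
  move=> Ss; apply: (@norm_closure_sub _ ( *%R s @^-1` norm_closure S)).
    apply: closed_subspace_preimage => //; last by exists (nm s) => v; exact: nmM.
    by move=> k u v; nc_ring R A.
  by move=> t St; apply: sub_norm_closure; exact: Sm.
move=> a b + hb; move: a.
apply: (@norm_closure_sub _ ( *%R^~ b @^-1` norm_closure S)).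
  apply: closed_subspace_preimage => //.
    by move=> k u v; nc_ring R A.
  by exists (nm b) => v; rewrite mulrC; exact: nmM.
by move=> s Ss; exact: H.
Qed.

End Closure.

(** * From words to resolvents, and the addition formula *)

Section Independence.
Context {R : realType} {A B : cstarAlgType R}.
Context (iota : {lrmorphism B -> A}) (E E' : {linear A -> B}).
Context (hspace : cstar_inf_prob_space iota E E').
Implicit Types (a p u r z x y : A) (b : B) (l : seq A).

(** A word cut at its distinguished letter r. The identities are written as vanishing defects, so
    that for two fixed arguments the solutions in the third form the common kernel of two bounded
    linear maps, a closed subspace. *)
Definition indep u r z :=
  E (u * r * z) - E (u * iota (E r) * z) = 0 /\
  E' (u * r * z) - (E (u * iota (E' r) * z) + E' (u * iota (E r) * z)) = 0.

Lemma indep_bounded : exists C, forall u r z,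
  nm (E (u * r * z) - E (u * iota (E r) * z)) <= C * (nm u * nm r * nm z) /\
  nm (E' (u * r * z) - (E (u * iota (E' r) * z) + E' (u * iota (E r) * z)))
    <= C * (nm u * nm r * nm z).
Proof.
have [M0 hM0] := E'_bounded hspace; pose M := `|M0|.
have M_ge0 : 0 <= M by exact: normr_ge0.
have hM a : nm (E' a) <= M * nm a.
  by rewrite (le_trans (hM0 a)) // ler_wpM2r ?nm_ge0 // ler_norm.
exists (2 + 3 * M) => u r z.
have u0 := nm_ge0 u; have r0 := nm_ge0 r; have z0 := nm_ge0 z.
have m3 a1 a2 a3 : nm (a1 * a2 * a3) <= nm a1 * nm a2 * nm a3.
  by rewrite (le_trans (nmM _ _)) // ler_wpM2r ?nm_ge0 // nmM.
set K := nm u * nm r * nm z; have K0 : 0 <= K by rewrite !mulr_ge0.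
have k1 : nm (u * r * z) <= K by exact: m3.
have k2 : nm (u * iota (E r) * z) <= K.
  rewrite (le_trans (m3 _ _ _)) // (nm_iota hspace) ler_wpM2r // ler_wpM2l //.
  exact: (E_contractive hspace).
have k3 : nm (u * iota (E' r) * z) <= M * K.
  rewrite (le_trans (m3 _ _ _)) // (nm_iota hspace).
  have -> : M * K = nm u * (M * nm r) * nm z by rewrite /K; ring.
  by rewrite ler_wpM2r // ler_wpM2l.
have c := E_contractive hspace.
split.
  have := nmB (E (u * r * z)) (E (u * iota (E r) * z)).
  have := c (u * r * z); have := c (u * iota (E r) * z).
  by nra.
have := nmB (E' (u * r * z)) (E (u * iota (E' r) * z) + E' (u * iota (E r) * z)).
have := nmD (E (u * iota (E' r) * z)) (E' (u * iota (E r) * z)).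
have := hM (u * r * z); have := hM (u * iota (E r) * z).
have := c (u * iota (E' r) * z).
have : M * nm (u * r * z) <= M * K by rewrite ler_wpM2l.
have : M * nm (u * iota (E r) * z) <= M * K by rewrite ler_wpM2l.
by lra.
Qed.

Let EP k a z : E (k *: a + z) = k *: E a + E z. Proof. exact: linearP. Qed.
Let E'P k a z : E' (k *: a + z) = k *: E' a + E' z. Proof. exact: linearP. Qed.
Let iP k b c : iota (k *: b + c) = k *: iota b + iota c.
Proof. exact: linearP. Qed.

Let lin2 (k : R[i]) (a1 a2 b1 b2 : B) :
  k *: a1 + a2 - (k *: b1 + b2) = k *: (a1 - b1) + (a2 - b2).
Proof. by nc_ring R B. Qed.

Let lin3 (k : R[i]) (a1 a2 b1 b2 c1 c2 : B) :
  k *: a1 + a2 - (k *: b1 + b2 + (k *: c1 + c2)) =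
  k *: (a1 - (b1 + c1)) + (a2 - (b2 + c2)).
Proof. by nc_ring R B. Qed.

Lemma closed_subspace_and V1 V2 : closed_subspace V1 -> closed_subspace V2 ->
  closed_subspace [set a : A | V1 a /\ V2 a].
Proof.
move=> h1 h2; have := @closed_subspaceI R A bool (fun i => if i then V1 else V2).
have h i : closed_subspace (if i then V1 else V2) by case: i.
move=> /(_ h); congr closed_subspace; apply/seteqP; split=> a /=.
  by move=> ha; split; [exact: (ha true)|exact: (ha false)].
by move=> [ha hb] [].
Qed.

Lemma indep_closedl r z : closed_subspace [set u | indep u r z].
Proof.
have [C hC] := indep_bounded.
apply: closed_subspace_and; apply: (closed_subspace_preimage _ _ (closed_subspace0 B)).
- move=> k u v; by rewrite !mulrDl -!scalerAl !EP lin2.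
- exists (C * (nm r * nm z)) => u; rewrite (le_trans (hC u r z).1) //.
  by rewrite le_eqVlt; apply/orP; left; apply/eqP; ring.
- move=> k u v; by rewrite !mulrDl -!scalerAl !EP !E'P lin3.
- exists (C * (nm r * nm z)) => u; rewrite (le_trans (hC u r z).2) //.
  by rewrite le_eqVlt; apply/orP; left; apply/eqP; ring.
Qed.

Lemma indep_closedm u z : closed_subspace [set r | indep u r z].
Proof.
have [C hC] := indep_bounded.
apply: closed_subspace_and; apply: (closed_subspace_preimage _ _ (closed_subspace0 B)).
- move=> k r s; rewrite !(EP, E'P) !iP !(mulrDl, mulrDr) -!(scalerAr, scalerAl) !EP.
  by rewrite lin2.
- exists (C * (nm u * nm z)) => r; rewrite (le_trans (hC u r z).1) //.
  by rewrite le_eqVlt; apply/orP; left; apply/eqP; ring.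
- move=> k r s; rewrite !(EP, E'P) !iP !(mulrDl, mulrDr) -!(scalerAr, scalerAl) !(EP, E'P).
  by rewrite lin3.
- exists (C * (nm u * nm z)) => r; rewrite (le_trans (hC u r z).2) //.
  by rewrite le_eqVlt; apply/orP; left; apply/eqP; ring.
Qed.

Lemma indep_closedr u r : closed_subspace [set z | indep u r z].
Proof.
have [C hC] := indep_bounded.
apply: closed_subspace_and; apply: (closed_subspace_preimage _ _ (closed_subspace0 B)).
- move=> k z w; by rewrite !mulrDr -!scalerAr !EP lin2.
- exists (C * (nm u * nm r)) => z; rewrite (le_trans (hC u r z).1) //.
  by rewrite le_eqVlt; apply/orP; left; apply/eqP; ring.
- move=> k z w; by rewrite !mulrDr -!scalerAr !EP !E'P lin3.
- exists (C * (nm u * nm r)) => z; rewrite (le_trans (hC u r z).2) //.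
  by rewrite le_eqVlt; apply/orP; left; apply/eqP; ring.
Qed.

Context (x y : A).
Context (hxy : inf_monotone_independent_pair iota E E' x y).

Let gx := generated_algebra iota x.
Let gy := generated_algebra iota y.

(** The neighbours u and p of r lie in the algebra of x, so the tail l may mix letters of both
    algebras freely. *)
Lemma indep_word u r p l : gx u -> gy r -> gx p ->
  (forall a, a \in l -> gx a \/ gy a) -> indep u r (p * \prod_(a <- l) a).
Proof.
move=> hu hr hp hl.
pose s := [:: u, r, p & l].
(* Positions count from 0: r is letter 1 and the tail starts at letter 3. A tail letter in both
   algebras gets the index of y; either choice would do. *)
pose idx k := match k with
  | 1%N => true | k.+3 => `[< gy (nth 0 l k) >] | _ => false end.
have [] := hxy.2 (size s) (nth 0 s) idx 1%N isT.
- move=> [|[|[|k]]] //= hk; case: asboolP => // ngy.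
  by have [] := hl _ (mem_nth 0 (hk : (k < size l)%N)).
- by [].
- by [].
rewrite /= big_ltn // big_nat1.
have -> : \prod_(1 <= k < (size l).+3) nth 0 s k = r * (p * \prod_(a <- l) a).
  rewrite big_ltn // big_ltn // (big_addn 0 _ 3) !subSS subn0 /= [in RHS](big_nth 0).
  by congr (_ * (_ * _)); apply: eq_bigr => k _; rewrite addn3.
have -> : \prod_(2 <= k < (size l).+3) nth 0 s k = p * \prod_(a <- l) a.
  rewrite big_ltn // (big_addn 0 _ 3) !subSS subn0 /= [in RHS](big_nth 0).
  by congr (_ * _); apply: eq_bigr => k _; rewrite addn3.
by rewrite !mulrA => e1 e2; split; rewrite ?mulrA ?e1 ?e2 subrr.
Qed.

Lemma gen_subalg x0 : subalgebra_over iota (generated_algebra iota x0).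
Proof.
split; last by move=> _ [b _ <-] V [[_ hV] _]; apply: hV; exists b.
split.
- by apply/mem_set => V [[[h _ _] _] _]; exact: set_mem.
- move=> k a b /set_mem ha /set_mem hb; apply/mem_set => V hV.
  have [[[_ h _] _] _] := hV; apply: set_mem; apply: h; apply/mem_set.
    exact: ha.
  exact: hb.
- move=> a b /set_mem ha /set_mem hb; apply/mem_set => V hV.
  have [[[_ _ h] _] _] := hV; apply: set_mem; apply: h; apply/mem_set.
    exact: ha.
  exact: hb.
Qed.

Let cx := norm_closure gx.
Let cy := norm_closure gy.

Lemma gen_closed x0 : let S := generated_algebra iota x0 in
  [/\ S 1, forall k a z, S a -> S z -> S (k *: a + z) &
      forall a z, S a -> S z -> S (a * z)].
Proof.
move=> S; have [[h1 h2 h3] _] := gen_subalg x0; split.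
- exact: set_mem h1.
- by move=> k a z /mem_set ha /mem_set hz; apply: set_mem; exact: h2.
- by move=> a z /mem_set ha /mem_set hz; apply: set_mem; exact: h3.
Qed.

Lemma gen_iota x0 b : generated_algebra iota x0 (iota b).
Proof. by apply: (gen_subalg x0).2; exists b. Qed.

Lemma gen_self x0 : generated_algebra iota x0 x0.
Proof. by move=> V [_]; apply. Qed.

Lemma gen_sub x0 b : generated_algebra iota x0 (iota b - x0).
Proof.
have [_ h _] := gen_closed x0; rewrite addrC -scaleN1r.
by apply: h; [exact: gen_self|exact: gen_iota].
Qed.

Lemma resolvent_closure x0 b : spos (im_part (iota b - x0)) ->
  norm_closure (generated_algebra iota x0) (iota b - x0)^-1.
Proof.
have [h1 h2 h3] := gen_closed x0; move=> /im_spos_inv[_]; apply.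
- exact: norm_closure_closed.
- exact: sub_norm_closure.
- move=> v hv; apply: norm_closure_mul => //.
  by apply: sub_norm_closure; exact: gen_sub.
Qed.

Lemma indep_closure u r z :
  (forall u r, gx u -> gy r -> indep u r z) -> cx u -> cy r -> indep u r z.
Proof.
move=> h hu; apply: (norm_closure_sub (indep_closedm u z)) => s hs /=.
move: u hu; apply: (norm_closure_sub (indep_closedl s z)) => t ht /=.
exact: h.
Qed.

Lemma indep_resolvent u r p b : spos (im_part (iota b - (x + y))) ->
  cx u -> cy r -> gx p -> indep u r (p * (iota b - (x + y))^-1).
Proof.
move=> hb hu hr hp; apply: indep_closure => // {hu hr}u {}r hu hr.
pose ok (l : seq A) := forall a, a \in l -> gx a \/ gy a.
(* Every prefix of letters is allowed before z. This makes the property stable under left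
   multiplication by the letters y and b - x, hence by b - (x + y), as the Neumann series
   requires. *)
pose V := [set z | forall q : {q : A * seq A | gx q.1 /\ ok q.2},
  indep u r ((sval q).1 * (\prod_(a <- (sval q).2) a * z))].
have cV : closed_subspace V.
  apply: closed_subspaceI => q.
  apply: (closed_subspace_preimage _ _ (indep_closedr u r)).
    by move=> k a c; rewrite !mulrDr -!scalerAr.
  exists (nm (sval q).1 * nm (\prod_(a <- (sval q).2) a)) => a.
  rewrite (le_trans (nmM _ _)) // -mulrA ler_wpM2l ?nm_ge0 //; exact: nmM.
have V1 : V 1 by move=> [[q l] /= [hq hl]]; rewrite mulr1; exact: indep_word.
have Vm c v : gx c \/ gy c -> V v -> V (c * v).
  move=> hc hv [[q l] /= [hq hl]].
  have hl' : ok (rcons l c).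
    by move=> a; rewrite mem_rcons in_cons => /orP[/eqP ->|/hl].
  have := hv (exist _ (q, rcons l c) (conj hq hl')).
  by rewrite /= -cats1 big_cat big_seq1 /= -(mulrA _ c).
have VW : V (iota b - (x + y))^-1.
  apply: (im_spos_inv hb).2 => // v hv.
  have -> : (iota b - (x + y)) * v = (-1) *: (y * v) + (iota b - x) * v.
    by nc_ring R A.
  by apply: cV.1; apply: Vm => //; [right; exact: gen_self|left; exact: gen_sub].
have nil_ok : ok [::] by [].
have := VW (exist _ (p, [::]) (conj hp nil_ok)).
by rewrite /= big_nil mul1r.
Qed.

(** A word that ends in r is read as one followed by the letter 1 of the algebra of x. *)
Lemma indep_one u r : cx u -> cy r -> indep u r 1.
Proof.
move=> hu hr; apply: indep_closure => // {hu hr}u {}r hu hr.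
have [h1 _ _] := gen_closed x.
by have := @indep_word u r 1 [::] hu hr h1; rewrite big_nil mulr1; apply.
Qed.

Lemma inf_cauchy_transform_add b : star x = x -> star y = y ->
  spos (im_part b) ->
  inf_cauchy_transform iota E' (x + y) b =
    E ((iota (F_transform iota E y b) - x)^-1
        * iota (F_transform iota E y b * inf_cauchy_transform iota E' y b
                * F_transform iota E y b)
        * (iota (F_transform iota E y b) - x)^-1)
    + inf_cauchy_transform iota E' x (F_transform iota E y b).
Proof.
move=> sx sy hb; set f := F_transform _ _ _ _; set g := inf_cauchy_transform _ _ y b.
have im_res c x0 : star x0 = x0 -> spos (im_part c) ->
    spos (im_part (iota c - x0)).
  move=> s0 hc; rewrite (im_part_iota_sub hspace) //; exact: (spos_iota hspace).
have hf := im_spos_F hspace sy hb; have uG := G_unit hspace sy hb.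
have hr := im_res b y sy hb; have hq := im_res f x sx hf.
have sxy : star (x + y) = x + y by rewrite starD sx sy.
have hw := im_res b (x + y) sxy hb.
have [ur _] := im_spos_inv hr; have [uq _] := im_spos_inv hq.
have [uw _] := im_spos_inv hw.
rewrite /inf_cauchy_transform.
set q := (iota f - x)^-1; set w := (iota b - (x + y))^-1.
pose r := (iota b - y)^-1.
have gE : g = E' r by [].
have fG : iota f * iota (E r) = 1 by rewrite -rmorphM mulVr ?rmorph1.
have [h1 h2 h3] := gen_closed x.
have cq : cx q by exact: resolvent_closure.
have cr : cy r by exact: resolvent_closure.
have ci c : cx (iota c) by apply: sub_norm_closure; exact: gen_iota.
have gxx : gx x by exact: gen_self.
have cxx : cx x by exact: sub_norm_closure.
have cm a c : cx a -> cx c -> cx (a * c) by exact: norm_closure_mul.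
have rw : w = r + r * (x * w).
  have : (iota b - y) * w = 1 + x * w.
    by rewrite -[1 in RHS](divrr uw) -/w; nc_ring R A.
  by move=> e; rewrite -[LHS](mulKr ur) e -/r mulrDr mulr1.
have qf : q * iota f = 1 + q * x.
  by rewrite -[1 in RHS](mulVr uq) -/q; nc_ring R A.
have fq : iota f * q = 1 + x * q.
  by rewrite -[1 in RHS](divrr uq) -/q; nc_ring R A.
(* In the prefix u q F the factor F cancels E(r) = F^-1. On the left, q F = 1 + q x splits u q F w
   into u w + u q x w, and E(u q x w) also stands on the right. *)
have Ew u : cx u -> E (u * w) = E (u * q).
  move=> hu; have hv : cx (u * q * iota f) by apply: (cm) => //; exact: cm.
  have [e1 _] := indep_one hv cr; have [e2 _] := indep_resolvent hw hv cr gxx.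
  move: e1 e2 => /eqP + /eqP.
  rewrite !subr_eq0 !mulr1 -(mulrA _ (iota f) (iota (E r))) fG mulr1 => /eqP e1 /eqP e2.
  have : E (u * q * iota f * w) = E (u * q) + E (u * q * (x * w)).
    by rewrite {1}rw mulrDr raddfD /= e1 [in LHS]mulrA e2.
  have -> : u * q * iota f * w = u * w + u * q * (x * w).
    by rewrite -(mulrA u) qf; nc_ring R A.
  by rewrite raddfD /= => /addIr.
have hv : cx (q * iota f) by exact: cm.
have [_ e1] := indep_one hv cr; have [_ e2] := indep_resolvent hw hv cr gxx.
move: e1 e2 => /eqP + /eqP.
rewrite !subr_eq0 !mulr1 -(mulrA _ (iota f) (iota (E r))) fG mulr1 -/w -gE => /eqP e1 /eqP e2.
have : E' (q * iota f * w) =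
    (E (q * iota f * iota g) + E' q) +
    (E (q * iota f * iota g * (x * w)) + E' (q * (x * w))).
  by rewrite {1}rw mulrDr raddfD /= e1 [in LHS]mulrA e2.
have -> : q * iota f * w = w + q * (x * w) by rewrite qf; nc_ring R A.
rewrite raddfD /= addrA => /addIr ->.
(* [Ew] is used with u = q F g x; then 1 + x q = F q merges the two E-terms into E(q F g F q). *)
rewrite (mulrA _ x w) Ew; last by apply: (cm) => //; exact: cm.
rewrite addrAC -raddfD /=; congr (E _ + _).
rewrite !rmorphM /= -!mulrA fq.
by nc_ring R A.
Qed.

End Independence.

Theorem theorem1p2 (R : realType) (A B : cstarAlgType R)
    (iota : {lrmorphism B -> A}) (E E' : {linear A -> B}) (x y : A)
    (hspace : cstar_inf_prob_space iota E E')
    (hx : self_adjoint x) (hy : self_adjoint y)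
    (hxy : inf_monotone_independent_pair iota E E' x y)
    (b : B) (hb : upper_half_plane b) :
  let G := cauchy_transform iota E in
  let F := F_transform iota E in
  let g := inf_cauchy_transform iota E' in
  g (x + y) b =
    'd (G x) (F y b) (- (F y b * g y b * F y b)) + g x (F y b).
Proof.
move=> G F g; have sb := upper_half_plane_spos hb.
rewrite /G (diff_cauchy_transform hspace _ hx); last exact: (im_spos_F hspace hy sb).
by rewrite linearN /= mulrN mulNr raddfN opprK; exact: inf_cauchy_transform_add.
Qed.
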